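(* Let $k$ be a field. If two finite groups $G$ and $G'$ are $k$-isocategorical, then for each positive integer $n$, the number of elements of order $n$ in $G$ is equal to the number of elements of order $n$ in $G'$.
   Context: For a Hopf algebra $H$ over a field $k$, $\mathrm{Mod}(H)$ denotes the $k$-linear monoidal category of left $H$-modules, with tensor product $V \otimes_k W$ on which $H$ acts through the comultiplication, $x\cdot(v\otimes w)=\sum x_{(1)}v\otimes x_{(2)}w$, and unit object $k$ on which $H$ acts through the counit. Two Hopf algebras $H$ and $L$ over $k$ are monoidally Morita equivalent if $\mathrm{Mod}(H)$ and $\mathrm{Mod}(L)$ are equivalent as $k$-linear monoidal categories. Two finite groups $G$ and $G'$ are $k$-isocategorical if the group algebras $kG$ and $kG'$ (with their usual Hopf algebra structures) are monoidally Morita equivalent. *)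

(* Defs.v *)
From HB Require Import structures.
From mathcomp Require Import all_boot all_order all_algebra all_fingroup.
From mathcomp Require Import generic_quotient sesquilinear ring_quotient boolp functions.
From mathcomp Require Import freeg.

Set Implicit Arguments.
Unset Strict Implicit.
Unset Printing Implicit Defensive.

Import GRing.Theory.

Local Open Scope ring_scope.
Local Open Scope quotient_scope.

Section LinearLemmas.
Variables (k : fieldType).

Lemma linD (U V : lmodType k) (f : U -> V) :
  linear f -> {morph f : x y / x + y}.
Proof. by move=> hf x y; have := hf 1 x y; rewrite !scale1r. Qed.

Lemma lin0 (U V : lmodType k) (f : U -> V) : linear f -> f 0 = 0.
Proof. by move=> hf; rewrite -[0 in LHS](addNr 0) -scaleN1r hf scaleN1r addNr. Qed.

Lemma linZ (U V : lmodType k) (f : U -> V) :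
  linear f -> forall a, {morph f : x / a *: x}.
Proof. by move=> hf a x; have := hf a x 0; rewrite (lin0 hf) !addr0. Qed.

Lemma lin_comp (U V W : lmodType k) (g : V -> W) (f : U -> V) :
  linear g -> linear f -> linear (fun x => g (f x)).
Proof. by move=> hg hf a x y /=; rewrite hf hg. Qed.

Lemma lin_id (U : lmodType k) : linear (fun x : U => x).
Proof. by []. Qed.

End LinearLemmas.

(* The tensor product over k: the free module on V * W modulo the submodule   *)
(* generated by the bilinearity relations.                                    *)

Section TensorDef.
Variables (k : fieldType) (V W : lmodType k).

Local Notation free := {freeg (V * W)%type / k}.

Inductive tensor_null : free -> Prop :=
| TNull0 : tensor_null 0
| TNullL a x y : tensor_null x -> tensor_null y -> tensor_null (a *: x + y)
| TNullDl v v' w : tensor_null (<< (v + v', w) >> - << (v, w) >> - << (v', w) >>)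
| TNullDr v w w' : tensor_null (<< (v, w + w') >> - << (v, w) >> - << (v, w') >>)
| TNullZl a v w : tensor_null (<< (a *: v, w) >> - a *: << (v, w) >>)
| TNullZr a v w : tensor_null (<< (v, a *: w) >> - a *: << (v, w) >>).

Definition tensor_nullb : {pred free} := fun x => `[< tensor_null x >].

Fact tensor_null_zmod_closed : zmod_closed tensor_nullb.
Proof.
split; first exact/asboolP/TNull0.
move=> x y /asboolP hx /asboolP hy; apply/asboolP.
by rewrite -scaleN1r addrC; apply: TNullL.
Qed.
HB.instance Definition _ :=
  GRing.isZmodClosed.Build free tensor_nullb tensor_null_zmod_closed.

Definition tensor := {ideal_quot tensor_nullb}.
HB.instance Definition _ := GRing.Zmodule.on tensor.

Let pi (x : free) : tensor := \pi_tensor x.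

Let pi_eq x y : pi x = pi y <-> tensor_null (x - y).
Proof.
rewrite /pi; split=> [/eqP|h].
  by rewrite -Quotient.idealrBE => /asboolP.
by apply/eqP; rewrite -Quotient.idealrBE; apply/asboolP.
Qed.

Let piD x y : pi (x + y) = pi x + pi y.
Proof. by rewrite /pi !piE. Qed.

Let pi0 : pi 0 = 0.
Proof. by apply: (addrI (pi 0)); rewrite -piD !addr0. Qed.

Let tensor_nullZ a x : tensor_null x -> tensor_null (a *: x).
Proof. by move=> h; rewrite -[_ *: _]addr0; apply: TNullL => //; apply: TNull0. Qed.

Definition tensor_scale (a : k) (x : tensor) : tensor := \pi_tensor (a *: repr x).

Let piZ a x : tensor_scale a (pi x) = pi (a *: x).
Proof.
apply/pi_eq; rewrite -scalerBr; apply: tensor_nullZ.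
by apply/pi_eq; rewrite /pi reprK.
Qed.

Let piK x : pi (repr x) = x.
Proof. exact: reprK. Qed.

Fact tensor_scaleA a b x :
  tensor_scale a (tensor_scale b x) = tensor_scale (a * b) x.
Proof. by rewrite -[x]piK !piZ scalerA. Qed.
Fact tensor_scale1 : left_id 1 tensor_scale.
Proof. by move=> x; rewrite -[x]piK piZ scale1r. Qed.
Fact tensor_scaleDr : right_distributive tensor_scale +%R.
Proof. by move=> a x y; rewrite -[x]piK -[y]piK -piD !piZ -piD scalerDr. Qed.
Fact tensor_scaleDl x : {morph tensor_scale^~ x : a b / a + b}.
Proof. by move=> a b; rewrite -[x]piK !piZ -piD scalerDl. Qed.
HB.instance Definition _ := GRing.Zmodule_isLmodule.Build k tensor
  tensor_scaleA tensor_scale1 tensor_scaleDr tensor_scaleDl.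

Definition tens (v : V) (w : W) : tensor := \pi_tensor << (v, w) >>.

Fact tens_bilinear : bilinear_for *:%R *:%R tens.
Proof.
have sZ a (x : tensor) : a *: x = tensor_scale a x by [].
split=> [w|v] a x y /=; rewrite /tens -!/(pi _).
  transitivity (pi << (a *: x, w) >> + pi << (y, w) >>).
    by rewrite -piD; apply/pi_eq; rewrite opprD addrA; apply: TNullDl.
  by congr (_ + _); rewrite sZ piZ; apply/pi_eq/TNullZl.
transitivity (pi << (v, a *: x) >> + pi << (v, y) >>).
  by rewrite -piD; apply/pi_eq; rewrite opprD addrA; apply: TNullDr.
by congr (_ + _); rewrite sZ piZ; apply/pi_eq/TNullZr.
Qed.

Lemma tens_ind (P : tensor -> Prop) :
  P 0 -> (forall v w, P (tens v w)) -> (forall x y, P x -> P y -> P (x + y)) ->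
  forall x, P x.
Proof.
move=> P0 Pt PD x; rewrite -[x]piK -[repr x]freeg_sumE.
elim: (dom _) => [|z s IH].
  by rewrite big_nil pi0.
rewrite big_cons piD; apply: PD => //.
have -> : pi << coeff z (repr x) *g z >> = tens (coeff z (repr x) *: z.1) z.2.
  rewrite (linZ (tens_bilinear.1 _)) [RHS]piZ -surjective_pairing; congr pi.
  by apply/eqP/freeg_eqP => t; rewrite coeffZ !coeffU mul1r.
exact: Pt.
Qed.

Section Lift.
Variables (U : lmodType k) (f : V -> W -> U).

Definition tlift (x : tensor) : U := fglift (fun p => f p.1 p.2) (repr x).

Hypothesis hf : bilinear_for *:%R *:%R f.

Let F := fglift (fun p : V * W => f p.1 p.2).

Let FD : {morph F : x y / x - y}.
Proof. exact: lift_is_additive. Qed.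

Let F0 : F 0 = 0.
Proof. by rewrite -(subrr 0) FD subrr. Qed.

Let FN x : F (- x) = - F x.
Proof. by rewrite -sub0r FD F0 sub0r. Qed.

Let FA x y : F (x + y) = F x + F y.
Proof. by rewrite -{1}[y]opprK FD FN opprK. Qed.

Let FZ a x : F (a *: x) = a *: F x.
Proof.
rewrite -[x]freeg_sumE scaler_sumr.
elim: (dom x) => [|z s IH]; first by rewrite !big_nil F0 scaler0.
rewrite !big_cons !FA IH scalerDr; congr (_ + _).
have -> : a *: << coeff z x *g z >> = << (a * coeff z x) *g z >>.
  by apply/eqP/freeg_eqP => t; rewrite coeffZ !coeffU mulrA.
by rewrite /F !liftU scalerA.
Qed.

Let F1 v w : F << (v, w) >> = f v w.
Proof. by rewrite /F liftU scale1r. Qed.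

Let F_null x : tensor_null x -> F x = 0.
Proof.
elim=> {x} => [|a x y _ hx _ hy|v v' w|v w w'|a v w|a v w].
- exact: F0.
- by rewrite FA FZ hx hy scaler0 addr0.
- by rewrite !FD !F1 (linD (hf.1 w)) addrAC addrK subrr.
- by rewrite !FD !F1 (linD (hf.2 v)) addrAC addrK subrr.
- by rewrite FD FZ !F1 (linZ (hf.1 w)) subrr.
- by rewrite FD FZ !F1 (linZ (hf.2 v)) subrr.
Qed.

Let tlift_pi x : tlift (pi x) = F x.
Proof.
apply/eqP; rewrite -subr_eq0 -FD; apply/eqP/F_null.
by apply/pi_eq; rewrite piK.
Qed.

Lemma tliftE v w : tlift (tens v w) = f v w.
Proof. by rewrite [LHS]tlift_pi F1. Qed.

Lemma tlift_linear : linear tlift.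
Proof.
move=> a x y; rewrite -[x]piK -[y]piK [_ *: _]piZ -piD !tlift_pi.
by rewrite FA FZ.
Qed.

End Lift.

Lemma tens_ext (U : lmodType k) (f g : tensor -> U) :
  linear f -> linear g -> (forall v w, f (tens v w) = g (tens v w)) ->
  f =1 g.
Proof.
move=> hf hg h; apply: tens_ind => [||x y hx hy]; rewrite ?(lin0 hf) ?(lin0 hg) //.
by rewrite (linD hf) (linD hg) hx hy.
Qed.

Lemma tliftL (U : lmodType k) (f g h : V -> W -> U) a :
  bilinear_for *:%R *:%R f -> bilinear_for *:%R *:%R g ->
  bilinear_for *:%R *:%R h ->
  (forall v w, h v w = a *: f v w + g v w) ->
  forall x, tlift h x = a *: tlift f x + tlift g x.
Proof.
move=> hf hg hh e; apply: tens_ext; first exact: tlift_linear.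
  move=> b x y; rewrite (tlift_linear hf) (tlift_linear hg) !scalerDr !scalerA.
  by rewrite [a * b]mulrC addrACA.
by move=> v w; rewrite !tliftE.
Qed.

End TensorDef.

Arguments tens {k V W}.
Arguments tensor {k} (V W)%_type_scope.

Notation "V *t W" := (tensor V W) (at level 40, left associativity) : type_scope.
Notation "v *t w" := (tens v w) (at level 40, left associativity) : ring_scope.

Section TensorTheory.
Variable k : fieldType.
Implicit Types V W U X : lmodType k.

Lemma tens0l V W (w : W) : (0 : V) *t w = 0.
Proof. exact: lin0 ((tens_bilinear V W).1 w). Qed.
Lemma tens0r V W (v : V) : v *t (0 : W) = 0.
Proof. exact: lin0 ((tens_bilinear V W).2 v). Qed.
Lemma tensDl V W (w : W) : {morph (fun v : V => v *t w) : x y / x + y}.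
Proof. exact: linD ((tens_bilinear V W).1 w). Qed.
Lemma tensDr V W (v : V) : {morph (fun w : W => v *t w) : x y / x + y}.
Proof. exact: linD ((tens_bilinear V W).2 v). Qed.
Lemma tensZl V W (w : W) a : {morph (fun v : V => v *t w) : x / a *: x}.
Proof. exact: linZ ((tens_bilinear V W).1 w) a. Qed.
Lemma tensZr V W (v : V) a : {morph (fun w : W => v *t w) : x / a *: x}.
Proof. exact: linZ ((tens_bilinear V W).2 v) a. Qed.
Definition tensE := (tens0l, tens0r, tensDl, tensDr, tensZl, tensZr).

Lemma tens_ind3 V W U (P : V *t W *t U -> Prop) :
  P 0 -> (forall v w u, P (v *t w *t u)) ->
  (forall x y, P x -> P y -> P (x + y)) -> forall x, P x.
Proof.
move=> P0 Pt PD; elim/tens_ind=> // x u.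
by elim/tens_ind: x => [|v w|x y hx hy]; rewrite ?tensE //; apply: PD.
Qed.

Lemma tens_eq V W X (f g : {linear tensor V W -> X}) :
  (forall v w, f (v *t w) = g (v *t w)) -> f =1 g.
Proof. by apply: tens_ext => a x y; rewrite linearP. Qed.

Lemma tens_ext3 V W U X (f g : V *t W *t U -> X) :
  linear f -> linear g ->
  (forall v w u, f (v *t w *t u) = g (v *t w *t u)) -> f =1 g.
Proof.
move=> lf lg e; apply: tens_ind3 => [|//|x y hx hy].
  by rewrite (lin0 lf) (lin0 lg).
by rewrite (linD lf) (linD lg) hx hy.
Qed.

Lemma tens_ext4 V W U Y X (f g : V *t W *t U *t Y -> X) :
  linear f -> linear g ->
  (forall v w u y, f (v *t w *t u *t y) = g (v *t w *t u *t y)) -> f =1 g.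
Proof.
move=> lf lg e; apply: tens_ext => // x y.
have ly : linear (fun x : V *t W *t U => x *t y).
  by move=> a z t; rewrite tensDl tensZl.
by move: x; apply: tens_ext3 => [||v w u];
  [exact: lin_comp lf ly | exact: lin_comp lg ly | exact: e].
Qed.

Lemma tens_eq3 V W U X (f g : {linear tensor (tensor V W) U -> X}) :
  (forall v w u, f (v *t w *t u) = g (v *t w *t u)) -> f =1 g.
Proof. by apply: tens_ext3 => a x y; rewrite linearP. Qed.

Section Map.
Variables (V W V' W' : lmodType k).

Definition tmap (f : V -> V') (g : W -> W') : V *t W -> V' *t W' :=
  tlift (fun v w => f v *t g w).

Variables (f : {linear V -> V'}) (g : {linear W -> W'}).

Fact tmap_bilinear : bilinear_for *:%R *:%R (fun v w => f v *t g w).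
Proof. by split=> u a x y /=; rewrite linearP !tensE. Qed.

HB.instance Definition _ := GRing.isLinear.Build k (tensor V W) (tensor V' W') *:%R
  (tmap f g) (tlift_linear tmap_bilinear).

Lemma tmapE v w : tmap f g (v *t w) = f v *t g w.
Proof. exact: tliftE tmap_bilinear _ _. Qed.
End Map.

Section Associator.
Variables (V W U : lmodType k).

Fact tassocr_bilinear (u : U) :
  bilinear_for *:%R *:%R (fun (v : V) (w : W) => v *t (w *t u)).
Proof. by split=> t a x y /=; rewrite !tensE. Qed.

Definition tassoc : V *t W *t U -> V *t (W *t U) :=
  tlift (fun x u => tlift (fun v w => v *t (w *t u)) x).

Fact tassoc_bilinear : bilinear_for *:%R *:%R
  (fun (x : V *t W) (u : U) => tlift (fun v w => v *t (w *t u)) x).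
Proof.
split=> [u|x] a y z /=; first by rewrite (tlift_linear (tassocr_bilinear u)).
apply: tliftL; try exact: tassocr_bilinear.
by move=> v w; rewrite !tensE.
Qed.

HB.instance Definition _ := GRing.isLinear.Build k (tensor (tensor V W) U)
  (tensor V (tensor W U)) *:%R tassoc (tlift_linear tassoc_bilinear).

Lemma tassocE v w u : tassoc (v *t w *t u) = v *t (w *t u).
Proof.
by rewrite /tassoc (tliftE tassoc_bilinear) (tliftE (tassocr_bilinear u)).
Qed.

Fact tassocl_bilinear (v : V) :
  bilinear_for *:%R *:%R (fun (w : W) (u : U) => v *t w *t u).
Proof. by split=> t a x y /=; rewrite !tensE. Qed.

Definition tassoc_inv : V *t (W *t U) -> V *t W *t U :=
  tlift (fun v x => tlift (fun w u => v *t w *t u) x).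

Fact tassoc_inv_bilinear : bilinear_for *:%R *:%R
  (fun (v : V) (x : W *t U) => tlift (fun w u => v *t w *t u) x).
Proof.
split=> [x|v] a y z /=; last by rewrite (tlift_linear (tassocl_bilinear v)).
apply: tliftL; try exact: tassocl_bilinear.
by move=> w u; rewrite !tensE.
Qed.

HB.instance Definition _ := GRing.isLinear.Build k (tensor V (tensor W U))
  (tensor (tensor V W) U) *:%R tassoc_inv (tlift_linear tassoc_inv_bilinear).

Lemma tassoc_invE v w u : tassoc_inv (v *t (w *t u)) = v *t w *t u.
Proof.
by rewrite /tassoc_inv (tliftE tassoc_inv_bilinear) (tliftE (tassocl_bilinear v)).
Qed.

Lemma tassocK : cancel tassoc tassoc_inv.
Proof.
apply: (tens_eq3 (f := tassoc_inv \o tassoc) (g := idfun)) => v w u /=.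
by rewrite tassocE tassoc_invE.
Qed.

Lemma tassoc_invK : cancel tassoc_inv tassoc.
Proof.
elim/tens_ind=> [|v x|x y hx hy]; first by rewrite !linear0.
  elim/tens_ind: x => [|w u|x y hx hy]; first by rewrite tens0r !linear0.
    by rewrite tassoc_invE tassocE.
  by rewrite tensDr !linearD /= hx hy.
by rewrite !linearD /= hx hy.
Qed.
End Associator.

Section Unitors.
Variable V : lmodType k.

Definition tlunit : k^o *t V -> V := tlift (fun (a : k^o) v => (a : k) *: v).

Fact tlunit_bilinear : bilinear_for *:%R *:%R (fun (a : k^o) (v : V) => (a : k) *: v).
Proof.
split=> [v|a] b x y /=; first by rewrite scalerDl scalerA.
by rewrite scalerDr !scalerA mulrC.
Qed.

HB.instance Definition _ := GRing.isLinear.Build k (tensor k^o V) V *:%R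
  tlunit (tlift_linear tlunit_bilinear).

Lemma tlunitE (a : k^o) v : tlunit (a *t v) = (a : k) *: v.
Proof. exact: tliftE tlunit_bilinear _ _. Qed.

Lemma tlunitK : cancel tlunit (fun v => 1 *t v).
Proof.
elim/tens_ind=> [|a v|x y hx hy]; first by rewrite linear0 tens0r.
  by rewrite tlunitE tensZr -tensZl /GRing.scale /= mulr1.
by rewrite linearD tensDr hx hy.
Qed.

Definition trunit : V *t k^o -> V := tlift (fun v (a : k^o) => (a : k) *: v).

Fact trunit_bilinear : bilinear_for *:%R *:%R (fun (v : V) (a : k^o) => (a : k) *: v).
Proof.
split=> [a|v] b x y /=; last by rewrite scalerDl scalerA.
by rewrite scalerDr !scalerA mulrC.
Qed.

HB.instance Definition _ := GRing.isLinear.Build k (tensor V k^o) V *:%R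
  trunit (tlift_linear trunit_bilinear).

Lemma trunitE v (a : k^o) : trunit (v *t a) = (a : k) *: v.
Proof. exact: tliftE trunit_bilinear _ _. Qed.

Lemma trunitK : cancel trunit (fun v => v *t 1).
Proof.
elim/tens_ind=> [|v a|x y hx hy]; first by rewrite linear0 tens0l.
  by rewrite trunitE tensZl -tensZr /GRing.scale /= mulr1.
by rewrite linearD tensDl hx hy.
Qed.
End Unitors.

Lemma tmapPl V W V' W' (f f' f'' : {linear V -> V'}) (g : {linear W -> W'}) a :
  (forall v, f v = a *: f' v + f'' v) ->
  forall x, tmap f g x = a *: tmap f' g x + tmap f'' g x.
Proof.
move=> e; apply: tliftL; try exact: tmap_bilinear.
by move=> v w; rewrite e !tensE.
Qed.

Lemma tmapPr V W V' W' (f : {linear V -> V'}) (g g' g'' : {linear W -> W'}) a :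
  (forall w, g w = a *: g' w + g'' w) ->
  forall x, tmap f g x = a *: tmap f g' x + tmap f g'' x.
Proof.
move=> e; apply: tliftL; try exact: tmap_bilinear.
by move=> v w; rewrite e !tensE.
Qed.

Lemma eq_tmap V W V' W' (f f' : V -> V') (g g' : W -> W') :
  f =1 f' -> g =1 g' -> tmap f g =1 tmap f' g'.
Proof. by move=> /funext-> /funext->. Qed.

Lemma tmap_id V W (x : V *t W) : tmap idfun idfun x = x.
Proof.
apply: (tens_eq (f := tmap idfun idfun) (g := idfun)) => v w /=.
by rewrite tmapE.
Qed.

Lemma tmap_comp V W V' W' V'' W'' (f' : {linear V' -> V''}) (f : {linear V -> V'})
    (g' : {linear W' -> W''}) (g : {linear W -> W'}) x :
  tmap f' g' (tmap f g x) = tmap (f' \o f) (g' \o g) x.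
Proof.
apply: (tens_eq (f := tmap f' g' \o tmap f g) (g := tmap (f' \o f) (g' \o g))).
by move=> v w /=; rewrite !tmapE.
Qed.

Lemma tassoc_tmap V W U V' W' U' (f : {linear V -> V'}) (g : {linear W -> W'})
    (h : {linear U -> U'}) x :
  tassoc (tmap (tmap f g) h x) = tmap f (tmap g h) (tassoc x).
Proof.
move: x; apply: tens_ext3 => [||v w u].
- by apply: lin_comp => a y z; rewrite linearP.
- by apply: lin_comp => a y z; rewrite linearP.
by rewrite !(tmapE, tassocE) /= !(tmapE, tassocE).
Qed.

Lemma tassoc_pentagon V W U X (x : V *t W *t U *t X) :
  tassoc (tassoc x) =
  tmap (@idfun V) (@tassoc W U X) (tassoc (tmap (@tassoc V W U) (@idfun X) x)).
Proof.
move: x; apply: tens_ext4 => [||v w u y].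
- by apply: lin_comp => a x y; rewrite linearP.
- by move=> a x y; rewrite !linearP.
by rewrite !(tassocE, tmapE) /= !tassocE tmapE /= tassocE.
Qed.

Lemma tassoc_triangle V W (x : V *t k^o *t W) :
  tmap (@idfun V) (@tlunit W) (tassoc x) = tmap (@trunit V) (@idfun W) x.
Proof.
move: x; apply: tens_ext3 => [||v a w].
- by apply: lin_comp => a x y; rewrite linearP.
- by move=> a x y; rewrite linearP.
by rewrite tassocE !tmapE /= tlunitE trunitE !tensE.
Qed.

End TensorTheory.

Record linCategory (k : fieldType) := LinCategory {
  obj :> Type;
  hom : obj -> obj -> lmodType k;
  idmor : forall A, hom A A;
  mcomp : forall A B C, hom B C -> hom A B -> hom A C;
  mcomp_bilinear : forall A B C, bilinear_for *:%R *:%R (@mcomp A B C);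
  mcompA : forall A B C D (h : hom C D) (g : hom B C) (f : hom A B),
    mcomp h (mcomp g f) = mcomp (mcomp h g) f;
  mcomp1m : forall A B (f : hom A B), mcomp (idmor B) f = f;
  mcompm1 : forall A B (f : hom A B), mcomp f (idmor A) = f
}.

Arguments hom {k l}.
Arguments idmor {k l}.
Arguments mcomp {k l A B C}.
Notation "g \mo f" := (mcomp g f) (at level 50, left associativity).

Definition is_iso (k : fieldType) (C : linCategory k) (A B : C) (f : hom A B) :=
  exists g : hom B A, g \mo f = idmor A /\ f \mo g = idmor B.

Record linFunctor (k : fieldType) (C D : linCategory k) := LinFunctor {
  fobj :> C -> D;
  fmap : forall A B, hom A B -> hom (fobj A) (fobj B);
  fmap_linear : forall A B, linear (@fmap A B);
  fmap1 : forall A, fmap (idmor A) = idmor (fobj A);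
  fmapM : forall A B E (g : hom B E) (f : hom A B),
    fmap (g \mo f) = fmap g \mo fmap f
}.

Arguments fmap {k C D} l {A B}.

Section FunctorConstructions.
Variable k : fieldType.

Definition idFunctor (C : linCategory k) : linFunctor C C :=
  @LinFunctor k C C (fun A => A) (fun A B f => f) (fun A B a f g => erefl)
    (fun A => erefl) (fun A B E g f => erefl).

Variables (C D E : linCategory k) (G : linFunctor D E) (F : linFunctor C D).

Fact compFunctor_linear A B : linear (fun f : hom A B => fmap G (fmap F f)).
Proof. by move=> a f g; rewrite !fmap_linear. Qed.
Fact compFunctor1 A : fmap G (fmap F (idmor A)) = idmor (G (F A)).
Proof. by rewrite !fmap1. Qed.
Fact compFunctorM A B X (g : hom B X) (f : hom A B) :
  fmap G (fmap F (g \mo f)) = fmap G (fmap F g) \mo fmap G (fmap F f).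
Proof. by rewrite !fmapM. Qed.

Definition compFunctor : linFunctor C E :=
  LinFunctor compFunctor_linear compFunctor1 compFunctorM.

End FunctorConstructions.

Definition nat_iso (k : fieldType) (C D : linCategory k) (F G : linFunctor C D) :=
  exists eta : forall A, hom (F A) (G A),
    (forall A, is_iso (eta A)) /\
    (forall A B (f : hom A B), eta B \mo fmap F f = fmap G f \mo eta A).

(* The quasi-inverse need not be monoidal: it automatically carries a monoidal
   structure transported from F. *)
Definition is_equivalence (k : fieldType) (C D : linCategory k)
    (F : linFunctor C D) :=
  exists G : linFunctor D C,
    nat_iso (compFunctor G F) (idFunctor C) /\
    nat_iso (compFunctor F G) (idFunctor D).

Record linMonCategory (k : fieldType) := LinMonCategory {
  lmc_cat :> linCategory k;
  tobj : lmc_cat -> lmc_cat -> lmc_cat;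
  thom : forall A A' B B' : lmc_cat,
    hom A A' -> hom B B' -> hom (tobj A B) (tobj A' B');
  tunit : lmc_cat;
  massoc : forall A B C, hom (tobj (tobj A B) C) (tobj A (tobj B C));
  mlunit : forall A, hom (tobj tunit A) A;
  mrunit : forall A, hom (tobj A tunit) A;
  thom_bilinear : forall A A' B B', bilinear_for *:%R *:%R (@thom A A' B B');
  thom1 : forall A B, thom (idmor A) (idmor B) = idmor (tobj A B);
  thomM : forall A A' A'' B B' B'' (f' : hom A' A'') (f : hom A A')
      (g' : hom B' B'') (g : hom B B'),
    thom (f' \mo f) (g' \mo g) = thom f' g' \mo thom f g;
  massoc_iso : forall A B C, is_iso (massoc A B C);
  mlunit_iso : forall A, is_iso (mlunit A);
  mrunit_iso : forall A, is_iso (mrunit A);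
  massoc_nat : forall A A' B B' C C' (f : hom A A') (g : hom B B') (h : hom C C'),
    massoc A' B' C' \mo thom (thom f g) h = thom f (thom g h) \mo massoc A B C;
  mlunit_nat : forall A A' (f : hom A A'),
    mlunit A' \mo thom (idmor tunit) f = f \mo mlunit A;
  mrunit_nat : forall A A' (f : hom A A'),
    mrunit A' \mo thom f (idmor tunit) = f \mo mrunit A;
  pentagon : forall A B C D,
    massoc A B (tobj C D) \mo massoc (tobj A B) C D =
    thom (idmor A) (massoc B C D) \mo massoc A (tobj B C) D
      \mo thom (massoc A B C) (idmor D);
  triangle : forall A B,
    thom (idmor A) (mlunit B) \mo massoc A tunit B = thom (mrunit A) (idmor B)
}.

Arguments tobj {k l}.
Arguments thom {k l A A' B B'}.
Arguments tunit {k}.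
Arguments massoc {k l}.
Arguments mlunit {k l}.
Arguments mrunit {k l}.

(* Monoidal functors are strong: mon2 and mon0 are isomorphisms. *)
Record linMonFunctor (k : fieldType) (C D : linMonCategory k) := LinMonFunctor {
  lmf_fun :> linFunctor C D;
  mon2 : forall A B, hom (tobj (lmf_fun A) (lmf_fun B)) (lmf_fun (tobj A B));
  mon0 : hom (tunit D) (lmf_fun (tunit C));
  mon2_iso : forall A B, is_iso (mon2 A B);
  mon0_iso : is_iso mon0;
  mon2_nat : forall A A' B B' (f : hom A A') (g : hom B B'),
    mon2 A' B' \mo thom (fmap lmf_fun f) (fmap lmf_fun g) =
    fmap lmf_fun (thom f g) \mo mon2 A B;
  mon_assoc : forall A B E,
    fmap lmf_fun (massoc A B E) \mo mon2 (tobj A B) E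
      \mo thom (mon2 A B) (idmor (lmf_fun E)) =
    mon2 A (tobj B E) \mo thom (idmor (lmf_fun A)) (mon2 B E)
      \mo massoc (lmf_fun A) (lmf_fun B) (lmf_fun E);
  mon_lunit : forall A,
    fmap lmf_fun (mlunit A) \mo mon2 (tunit C) A
      \mo thom mon0 (idmor (lmf_fun A)) = mlunit (lmf_fun A);
  mon_runit : forall A,
    fmap lmf_fun (mrunit A) \mo mon2 A (tunit C)
      \mo thom (idmor (lmf_fun A)) mon0 = mrunit (lmf_fun A)
}.

Definition monoidally_equivalent (k : fieldType) (C D : linMonCategory k) :=
  exists F : linMonFunctor C D, is_equivalence F.

Fact mulrl_linear (k : fieldType) (A : algType k) (a : A) : linear ( *%R a).
Proof. by move=> c x y; rewrite mulrDr scalerAr. Qed.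
HB.instance Definition _ (k : fieldType) (A : algType k) (a : A) :=
  GRing.isLinear.Build k A A *:%R ( *%R a) (mulrl_linear a).

(* (a *t b) (c *t d) = (a * c) *t (b * d) *)
Definition tmul (k : fieldType) (A : algType k) (x y : A *t A) : A *t A :=
  tlift (fun a b => tmap ( *%R a) ( *%R b) y) x.

Record hopfAlgebra (k : fieldType) := HopfAlgebra {
  hopf_alg :> algType k;
  comul : {linear hopf_alg -> tensor hopf_alg hopf_alg};
  counit : {linear hopf_alg -> k^o};
  antipode : {linear hopf_alg -> hopf_alg};
  comul1 : comul 1 = 1 *t 1;
  comulM : forall x y, comul (x * y) = tmul (comul x) (comul y);
  counit1 : counit 1 = 1;
  counitM : forall x y, counit (x * y) = (counit x : k) * counit y;
  comulA : forall x,
    tassoc (tmap comul idfun (comul x)) = tmap idfun comul (comul x);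
  counitl : forall x, tlunit (tmap counit idfun (comul x)) = x;
  counitr : forall x, trunit (tmap idfun counit (comul x)) = x;
  antipodel : forall x,
    tlift *%R (tmap antipode idfun (comul x)) = (counit x : k)%:A;
  antipoder : forall x,
    tlift *%R (tmap idfun antipode (comul x)) = (counit x : k)%:A
}.

Arguments comul {k} h.
Arguments counit {k} h.
Arguments antipode {k} h.

(* A left A-module, with its underlying k-vector space as part of the data;
   bilinearity of lmact makes the two k-structures agree. *)
Record leftModule (k : fieldType) (A : algType k) := LeftModule {
  lm_sort :> lmodType k;
  lmact : A -> lm_sort -> lm_sort;
  lmact_bilinear : bilinear_for *:%R *:%R lmact;
  lmact1 : forall v, lmact 1 v = v;
  lmactM : forall x y v, lmact (x * y) v = lmact x (lmact y v)
}.

Arguments lmact {k A l}.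

HB.instance Definition _ (k : fieldType) (A : algType k) (M : leftModule A) x :=
  GRing.isLinear.Build k M M *:%R (lmact x) ((lmact_bilinear M).2 x).

Definition actl (k : fieldType) (A : algType k) (M : leftModule A) (v : M)
  (x : A) : M := lmact x v.
HB.instance Definition _ (k : fieldType) (A : algType k) (M : leftModule A)
    (v : M) :=
  GRing.isLinear.Build k A M *:%R (actl v) ((lmact_bilinear M).1 v).

Section ModuleHom.
Variables (k : fieldType) (A : algType k) (M N : leftModule A).

Definition equivariant : {pred M -> N} :=
  fun f => `[< linear f /\ forall x v, f (lmact x v) = lmact x (f v) >].

Fact equivariant_submod_closed : submod_closed equivariant.
Proof.
split=> [|a f g /asboolP[lf hf] /asboolP[lg hg]]; apply/asboolP; split.
- by move=> a x y /=; rewrite scaler0 addr0.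
- by move=> x v /=; rewrite linear0.
- by move=> b x y /=; rewrite !fctE lf lg !scalerDr !scalerA [a * b]mulrC addrACA.
- by move=> x v /=; rewrite !fctE linearP hf hg.
Qed.
HB.instance Definition _ :=
  GRing.isSubmodClosed.Build k (M -> N) equivariant equivariant_submod_closed.

Record moduleHom := ModuleHom {
  mh_fun :> M -> N;
  mh_funP : mh_fun \in equivariant
}.

HB.instance Definition _ := [isSub for mh_fun].
HB.instance Definition _ := [Choice of moduleHom by <:].
HB.instance Definition _ := [SubChoice_isSubLmodule of moduleHom by <:].

Lemma moduleHom_linear (f : moduleHom) : linear f.
Proof. by have /asboolP[] := mh_funP f. Qed.
HB.instance Definition _ (f : moduleHom) :=
  GRing.isLinear.Build k M N *:%R f (moduleHom_linear f).

Lemma moduleHom_act (f : moduleHom) x v : f (lmact x v) = lmact x (f v).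
Proof. by have /asboolP[_] := mh_funP f. Qed.

Lemma moduleHomP (f g : moduleHom) : f =1 g -> f = g.
Proof. by move=> e; apply/val_inj/funext. Qed.

Fact mkModuleHom_subproof (f : {linear M -> N}) :
  (forall x v, f (lmact x v) = lmact x (f v)) -> (f : M -> N) \in equivariant.
Proof. by move=> hf; apply/asboolP; split=> // a u v; rewrite linearP. Qed.

Definition mkModuleHom (f : {linear M -> N})
    (hf : forall x v, f (lmact x v) = lmact x (f v)) : moduleHom :=
  ModuleHom (mkModuleHom_subproof hf).

End ModuleHom.

Section ModuleCategory.
Variables (k : fieldType) (A : algType k).
Implicit Types M N P Q : leftModule A.

Fact idHom_subproof M : forall x (v : M), idfun (lmact x v) = lmact x (idfun v).
Proof. by []. Qed.
Definition idHom M : moduleHom M M := mkModuleHom (f := idfun) (@idHom_subproof M).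

Fact compHom_subproof M N P (g : moduleHom N P) (f : moduleHom M N) :
  forall x v, (g \o f) (lmact x v) = lmact x ((g \o f) v).
Proof. by move=> x v /=; rewrite !moduleHom_act. Qed.
Definition compHom M N P (g : moduleHom N P) (f : moduleHom M N) :
  moduleHom M P := mkModuleHom (f := g \o f) (compHom_subproof g f).

Fact compHom_bilinear M N P : bilinear_for *:%R *:%R (@compHom M N P).
Proof.
split=> [f|g] a x y; apply: moduleHomP => v //=.
by rewrite [LHS]linearP.
Qed.
Fact compHomA M N P Q (h : moduleHom P Q) (g : moduleHom N P) (f : moduleHom M N) :
  compHom h (compHom g f) = compHom (compHom h g) f.
Proof. exact: moduleHomP. Qed.
Fact comp1Hom M N (f : moduleHom M N) : compHom (idHom N) f = f.
Proof. exact: moduleHomP. Qed.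
Fact compHom1 M N (f : moduleHom M N) : compHom f (idHom M) = f.
Proof. exact: moduleHomP. Qed.

Definition ModCat : linCategory k :=
  @LinCategory k (leftModule A) (fun M N => moduleHom M N) idHom compHom
    compHom_bilinear compHomA comp1Hom compHom1.

Lemma ModCat_iso M N (f : moduleHom M N) (g : N -> M) :
  cancel f g -> cancel g f -> @is_iso k ModCat M N f.
Proof.
move=> fK gK.
have gP : g \in @equivariant _ _ N M.
  apply/asboolP; split=> [a x y|x v]; apply: (can_inj fK); rewrite gK.
    by rewrite moduleHom_linear !gK.
  by rewrite moduleHom_act gK.
by exists (ModuleHom gP); split; apply: moduleHomP => v; [apply: fK|apply: gK].
Qed.

End ModuleCategory.

Section TensorAction.
Variables (k : fieldType) (A : algType k).

Section Two.
Variables (V W : leftModule A).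

(* (a *t b) (v *t w) = (a v) *t (b w) *)
Definition tact (x : A *t A) (t : V *t W) : V *t W :=
  tlift (fun a b => tmap (lmact a) (lmact b) t) x.

Fact tact_bilinear_subproof (t : V *t W) :
  bilinear_for *:%R *:%R (fun a b : A => tmap (lmact a) (lmact b) t).
Proof.
split=> [b|a] c x y /=; apply: tmapPl || apply: tmapPr.
  by move=> v /=; rewrite (lmact_bilinear V).1.
by move=> v /=; rewrite (lmact_bilinear W).1.
Qed.

Lemma tactE a b v w : tact (a *t b) (v *t w) = lmact a v *t lmact b w.
Proof. by rewrite /tact (tliftE (tact_bilinear_subproof _)) tmapE. Qed.

Fact tact_bilinear : bilinear_for *:%R *:%R tact.
Proof.
split=> [t|x] a y z /=; first exact: (tlift_linear (tact_bilinear_subproof t)).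
by apply: tliftL; try exact: tact_bilinear_subproof; move=> b c; rewrite linearP.
Qed.

HB.instance Definition _ x :=
  GRing.isLinear.Build k (tensor V W) (tensor V W) *:%R (tact x) (tact_bilinear.2 x).

Lemma tact0l t : tact 0 t = 0.
Proof. exact: lin0 (tact_bilinear.1 t). Qed.
Lemma tactDl t : {morph tact^~ t : x y / x + y}.
Proof. exact: linD (tact_bilinear.1 t). Qed.

Lemma tact_pure x v w : tact x (v *t w) = tmap (actl v) (actl w) x.
Proof.
elim/tens_ind: x => [|a b|x y hx hy]; first by rewrite tact0l linear0.
  by rewrite tactE tmapE.
by rewrite tactDl linearD /= hx hy.
Qed.

Lemma tact1 t : tact (1 *t 1) t = t.
Proof.
apply: (tens_eq (f := tact (1 *t 1)) (g := idfun)) => v w /=.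
by rewrite tactE !lmact1.
Qed.

Fact tmul_bilinear_subproof (y : A *t A) :
  bilinear_for *:%R *:%R (fun a b : A => tmap ( *%R a) ( *%R b) y).
Proof.
split=> [b|a] c x z /=; apply: tmapPl || apply: tmapPr.
  by move=> v /=; rewrite mulrDl -scalerAl.
by move=> v /=; rewrite mulrDl -scalerAl.
Qed.

Lemma tmulE (a b c d : A) : tmul (a *t b) (c *t d) = (a * c) *t (b * d).
Proof. by rewrite /tmul (tliftE (tmul_bilinear_subproof _)) tmapE. Qed.

Fact tmul_bilinear : bilinear_for *:%R *:%R (@tmul k A).
Proof.
split=> [t|x] a y z /=; first exact: (tlift_linear (tmul_bilinear_subproof t)).
by apply: tliftL; try exact: tmul_bilinear_subproof; move=> b c; rewrite linearP.
Qed.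

Lemma tactM x y t : tact (tmul x y) t = tact x (tact y t).
Proof.
elim/tens_ind: x => [|a b|x x' hx hx'].
- by rewrite (lin0 (tmul_bilinear.1 y)) !tact0l.
- elim/tens_ind: y => [|c d|y y' hy hy'].
  + by rewrite (lin0 (tmul_bilinear.2 _)) !tact0l linear0.
  + rewrite tmulE; elim/tens_ind: t => [|v w|t u ht hu].
    * by rewrite !linear0.
    * by rewrite !tactE !lmactM.
    * by rewrite !linearD /= ht hu.
  + by rewrite (linD (tmul_bilinear.2 _)) !tactDl linearD /= hy hy'.
- by rewrite (linD (tmul_bilinear.1 y)) !tactDl hx hx'.
Qed.

End Two.

End TensorAction.

Section ModMonoidal.
Variables (k : fieldType) (H : hopfAlgebra k).
Implicit Types V W U : leftModule H.

Fact tensorMod_bilinear V W :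
  bilinear_for *:%R *:%R (fun x : H => tact (V := V) (W := W) (comul H x)).
Proof.
split=> [t|x] a y z /=; last by rewrite linearP.
by rewrite linearP (tact_bilinear V W).1.
Qed.
Fact tensorMod1 V W (t : V *t W) : tact (comul H 1) t = t.
Proof. by rewrite comul1 tact1. Qed.
Fact tensorModM V W x y (t : V *t W) :
  tact (comul H (x * y)) t = tact (comul H x) (tact (comul H y) t).
Proof. by rewrite comulM tactM. Qed.

(* x (v *t w) = \sum (x_(1) v) *t (x_(2) w), with comul x = \sum x_(1) *t x_(2) *)
Definition tensorMod V W : leftModule H :=
  LeftModule (@tensorMod_bilinear V W) (@tensorMod1 V W) (@tensorModM V W).

Lemma act_tensorE V W x (t : V *t W) :
  lmact x (t : tensorMod V W) = tact (comul H x) t.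
Proof. by []. Qed.

Lemma act_linear V x : linear (lmact x : V -> V).
Proof. exact: (lmact_bilinear V).2 x. Qed.

Lemma lmactT V W x v w :
  lmact x (v *t w : tensorMod V W) = tmap (actl v) (actl w) (comul H x).
Proof. exact: tact_pure. Qed.

Fact unitMod_bilinear :
  bilinear_for *:%R *:%R (fun (x : H) (a : k^o) => (counit H x : k) *: a).
Proof.
split=> [a|x] b y z /=; first by rewrite linearP scalerDl -scalerA.
by rewrite linearP.
Qed.
Fact unitMod1 (a : k^o) : (counit H 1 : k) *: a = a.
Proof. by rewrite counit1 scale1r. Qed.
Fact unitModM x y (a : k^o) :
  (counit H (x * y) : k) *: a = (counit H x : k) *: ((counit H y : k) *: a).
Proof. by rewrite counitM scalerA. Qed.

Definition unitMod : leftModule H :=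
  LeftModule unitMod_bilinear unitMod1 unitModM.

Fact tensorHom_subproof V V' W W' (f : moduleHom V V') (g : moduleHom W W') :
  forall x (t : tensorMod V W),
  tmap f g (lmact x t) = lmact x (tmap f g t : tensorMod V' W').
Proof.
move=> x; have lfg : linear (tmap f g) by move=> a t u; rewrite linearP.
apply: tens_ext => [||v w].
- exact: lin_comp lfg (@act_linear (tensorMod V W) x).
- exact: lin_comp (@act_linear (tensorMod V' W') x) lfg.
rewrite tmapE !lmactT tmap_comp.
by apply: eq_tmap => a /=; rewrite /actl moduleHom_act.
Qed.
Definition tensorHom V V' W W' (f : moduleHom V V') (g : moduleHom W W') :
  moduleHom (tensorMod V W) (tensorMod V' W') :=
  mkModuleHom (M := tensorMod V W) (N := tensorMod V' W') (f := tmap f g)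
    (tensorHom_subproof f g).

Fact assocHom_subproof V W U :
  forall x (t : tensorMod (tensorMod V W) U),
  tassoc (lmact x t : V *t W *t U) =
  lmact x (tassoc (t : V *t W *t U) : tensorMod V (tensorMod W U)).
Proof.
move=> x; have la : linear (@tassoc k V W U) by move=> a t u; rewrite linearP.
apply: tens_ext3 => [||v w u].
- exact: lin_comp la (@act_linear (tensorMod (tensorMod V W) U) x).
- exact: lin_comp (@act_linear (tensorMod V (tensorMod W U)) x) la.
rewrite tassocE !lmactT.
transitivity (tassoc (tmap (tmap (actl v) (actl w)) (actl u)
  (tmap (comul H) idfun (comul H x)))).
  congr tassoc; rewrite tmap_comp; apply: eq_tmap => // a.
  by rewrite /actl lmactT.
rewrite tassoc_tmap comulA tmap_comp; apply: eq_tmap => // a.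
by rewrite /actl lmactT.
Qed.
Definition assocHom V W U :
  moduleHom (tensorMod (tensorMod V W) U) (tensorMod V (tensorMod W U)) :=
  mkModuleHom (M := tensorMod (tensorMod V W) U)
    (N := tensorMod V (tensorMod W U)) (f := @tassoc k V W U)
    (@assocHom_subproof V W U).

Definition counit_scale (a : k^o) (x : H) : k^o := (counit H x : k) *: a.
HB.instance Definition _ (a : k^o) :=
  GRing.isLinear.Build k H k^o *:%R (counit_scale a) (unitMod_bilinear.1 a).

Fact lunitHom_subproof V :
  forall x (t : tensorMod unitMod V), tlunit (lmact x t) = lmact x (tlunit t : V).
Proof.
move=> x; have lu : linear (@tlunit k V) by move=> a t u; rewrite linearP.
apply: tens_ext => [||a v].
- exact: lin_comp lu (@act_linear (tensorMod unitMod V) x).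
- exact: lin_comp (@act_linear V x) lu.
have key (y : H *t H) : tlunit (tmap (counit_scale a) (actl v) y) =
    (a : k) *: actl v (tlunit (tmap (counit H) idfun y)).
  elim/tens_ind: y => [|b c|y z hy hz].
  - by rewrite !linear0.
  - rewrite !tmapE !tlunitE linearZ /= -[counit_scale a b]/((counit H b : k) * a).
    by rewrite !scalerA mulrC.
  - by rewrite !linearD /= hy hz.
by rewrite tlunitE lmactT linearZ /= -[in RHS](counitl x); exact: key.
Qed.
Definition lunitHom V : moduleHom (tensorMod unitMod V) V :=
  mkModuleHom (M := tensorMod unitMod V) (f := @tlunit k V)
    (@lunitHom_subproof V).

Fact runitHom_subproof V :
  forall x (t : tensorMod V unitMod), trunit (lmact x t) = lmact x (trunit t : V).
Proof.
move=> x; have lu : linear (@trunit k V) by move=> a t u; rewrite linearP.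
apply: tens_ext => [||v a].
- exact: lin_comp lu (@act_linear (tensorMod V unitMod) x).
- exact: lin_comp (@act_linear V x) lu.
have key (y : H *t H) : trunit (tmap (actl v) (counit_scale a) y) =
    (a : k) *: actl v (trunit (tmap idfun (counit H) y)).
  elim/tens_ind: y => [|c b|y z hy hz].
  - by rewrite !linear0.
  - rewrite !tmapE !trunitE linearZ /= -[counit_scale a b]/((counit H b : k) * a).
    by rewrite !scalerA mulrC.
  - by rewrite !linearD /= hy hz.
by rewrite trunitE lmactT linearZ /= -[in RHS](counitr x); exact: key.
Qed.
Definition runitHom V : moduleHom (tensorMod V unitMod) V :=
  mkModuleHom (M := tensorMod V unitMod) (f := @trunit k V)
    (@runitHom_subproof V).

Fact tensorHom_bilinear V V' W W' :
  bilinear_for *:%R *:%R (@tensorHom V V' W W').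
Proof.
split=> [g|f] a y z; apply: moduleHomP => t; first exact: tmapPl.
exact: tmapPr.
Qed.

Fact tensorHom1 V W : tensorHom (idHom V) (idHom W) = idHom (tensorMod V W).
Proof. by apply: moduleHomP => t; apply: tmap_id. Qed.

Fact tensorHomM V V' V'' W W' W'' (f' : moduleHom V' V'') (f : moduleHom V V')
    (g' : moduleHom W' W'') (g : moduleHom W W') :
  tensorHom (compHom f' f) (compHom g' g) =
  compHom (tensorHom f' g') (tensorHom f g).
Proof. by apply: moduleHomP => t /=; rewrite tmap_comp. Qed.

Fact assocHom_iso V W U :
  @is_iso k (ModCat H) _ _ (assocHom V W U).
Proof.
exact: (@ModCat_iso k H _ _ (assocHom V W U) _ (@tassocK k V W U)
  (@tassoc_invK k V W U)).
Qed.

Fact lunitHom_iso V : @is_iso k (ModCat H) _ _ (lunitHom V).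
Proof.
apply: (@ModCat_iso k H _ _ (lunitHom V) _ (@tlunitK k V)) => v /=.
by rewrite tlunitE scale1r.
Qed.

Fact runitHom_iso V : @is_iso k (ModCat H) _ _ (runitHom V).
Proof.
apply: (@ModCat_iso k H _ _ (runitHom V) _ (@trunitK k V)) => v /=.
by rewrite trunitE scale1r.
Qed.

Fact assocHom_nat V V' W W' U U' (f : moduleHom V V') (g : moduleHom W W')
    (h : moduleHom U U') :
  compHom (assocHom V' W' U') (tensorHom (tensorHom f g) h) =
  compHom (tensorHom f (tensorHom g h)) (assocHom V W U).
Proof. by apply: moduleHomP => t /=; rewrite tassoc_tmap. Qed.

Fact lunitHom_nat V V' (f : moduleHom V V') :
  compHom (lunitHom V') (tensorHom (idHom unitMod) f) = compHom f (lunitHom V).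
Proof.
apply: moduleHomP => t; apply: (tens_eq (f := @tlunit k V' \o tmap idfun f)
  (g := f \o @tlunit k V)) t => a v /=.
by rewrite tmapE !tlunitE linearZ.
Qed.

Fact runitHom_nat V V' (f : moduleHom V V') :
  compHom (runitHom V') (tensorHom f (idHom unitMod)) = compHom f (runitHom V).
Proof.
apply: moduleHomP => t; apply: (tens_eq (f := @trunit k V' \o tmap f idfun)
  (g := f \o @trunit k V)) t => v a /=.
by rewrite tmapE !trunitE linearZ.
Qed.

Fact tensorMod_pentagon V W U X :
  compHom (assocHom V W (tensorMod U X)) (assocHom (tensorMod V W) U X) =
  compHom (compHom (tensorHom (idHom V) (assocHom W U X))
                   (assocHom V (tensorMod W U) X))
          (tensorHom (assocHom V W U) (idHom X)).
Proof.
apply: moduleHomP => t; exact: tassoc_pentagon.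
Qed.

Fact tensorMod_triangle V W :
  compHom (tensorHom (idHom V) (lunitHom W)) (assocHom V unitMod W) =
  tensorHom (runitHom V) (idHom W).
Proof.
apply: moduleHomP => t; exact: tassoc_triangle.
Qed.

Definition Mod : linMonCategory k :=
  @LinMonCategory k (ModCat H) tensorMod tensorHom unitMod
    assocHom lunitHom runitHom
    tensorHom_bilinear tensorHom1 tensorHomM
    assocHom_iso lunitHom_iso runitHom_iso
    assocHom_nat lunitHom_nat runitHom_nat
    tensorMod_pentagon tensorMod_triangle.

End ModMonoidal.

Definition monoidally_Morita_equivalent (k : fieldType) (H L : hopfAlgebra k) :=
  monoidally_equivalent (Mod H) (Mod L).

(* The group algebra kG, with the convolution product on functions G -> k.    *)

Definition groupAlg (k : fieldType) (G : finGroupType) := {ffun G -> k^o}.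

Section GroupAlgebra.
Variables (k : fieldType) (G : finGroupType).
Local Notation kG := (groupAlg k G).
Implicit Types (f g : kG) (x y z : G).

HB.instance Definition _ := GRing.Lmodule.on kG.

Definition gelt x : kG := [ffun y => (y == x)%:R].

Definition galg_mul f g : kG := [ffun x => \sum_y f y * g (y^-1 * x)%g].

Fact galg_mulA : associative galg_mul.
Proof.
move=> f g h; apply/ffunP=> x; rewrite !ffunE.
under eq_bigr do rewrite ffunE mulr_sumr.
under [RHS]eq_bigr do rewrite ffunE mulr_suml.
rewrite [RHS]exchange_big; apply: eq_bigr => y _.
rewrite [RHS](reindex_inj (mulgI y)); apply: eq_bigr => z _ /=.
by rewrite mulKg invMg mulgA mulrA.
Qed.

Lemma galg_geltl x f : galg_mul (gelt x) f = [ffun y => f (x^-1 * y)%g].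
Proof.
apply/ffunP=> y; rewrite !ffunE (bigD1 x) //= big1 => [|z nz].
  by rewrite ffunE eqxx mul1r addr0.
by rewrite ffunE (negPf nz) mul0r.
Qed.

Lemma galg_geltr x f : galg_mul f (gelt x) = [ffun y => f (y * x^-1)%g].
Proof.
apply/ffunP=> y; rewrite !ffunE (bigD1 (y * x^-1)%g) //= big1 => [|z nz].
  by rewrite ffunE invMg invgK mulgKV eqxx mulr1 addr0.
rewrite ffunE (_ : _ == x = false) ?mulr0 //; apply: contraNF nz => /eqP <-.
by rewrite invMg invgK mulKVg.
Qed.

Fact galg_mul1f : left_id (gelt 1%g) galg_mul.
Proof. by move=> f; rewrite galg_geltl; apply/ffunP=> y; rewrite ffunE invg1 mul1g. Qed.
Fact galg_mulf1 : right_id (gelt 1%g) galg_mul.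
Proof. by move=> f; rewrite galg_geltr; apply/ffunP=> y; rewrite ffunE invg1 mulg1. Qed.
Fact galg_mulDl : left_distributive galg_mul +%R.
Proof.
move=> f g h; apply/ffunP=> x; rewrite !ffunE -big_split; apply: eq_bigr => y _.
by rewrite ffunE mulrDl.
Qed.
Fact galg_mulDr : right_distributive galg_mul +%R.
Proof.
move=> f g h; apply/ffunP=> x; rewrite !ffunE -big_split; apply: eq_bigr => y _.
by rewrite ffunE mulrDr.
Qed.
Fact galg_1neq0 : gelt 1%g != 0.
Proof. by apply/eqP=> /ffunP/(_ 1%g)/eqP; rewrite !ffunE eqxx oner_eq0. Qed.
HB.instance Definition _ := GRing.Zmodule_isNzRing.Build kG
  galg_mulA galg_mul1f galg_mulf1 galg_mulDl galg_mulDr galg_1neq0.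

Fact galg_scaleAl (a : k) f g : a *: (f * g) = (a *: f) * g.
Proof.
apply/ffunP=> x; rewrite !ffunE scaler_sumr; apply: eq_bigr => y _.
by rewrite ffunE -scalerAl.
Qed.
HB.instance Definition _ := GRing.Lmodule_isLalgebra.Build k kG galg_scaleAl.
Fact galg_scaleAr (a : k) f g : a *: (f * g) = f * (a *: g).
Proof.
apply/ffunP=> x; rewrite !ffunE scaler_sumr; apply: eq_bigr => y _.
by rewrite ffunE -scalerAr.
Qed.
HB.instance Definition _ := GRing.Lalgebra_isAlgebra.Build k kG galg_scaleAr.

Lemma gelt1 : gelt 1%g = 1 :> kG. Proof. by []. Qed.
Lemma geltM x y : gelt (x * y)%g = gelt x * gelt y.
Proof.
rewrite [RHS]galg_geltl; apply/ffunP=> z; rewrite !ffunE.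
by rewrite -(inj_eq (mulgI x) (x^-1 * z)%g) mulKVg.
Qed.

Lemma gelt_sum f : f = \sum_x (f x : k) *: gelt x.
Proof.
apply/ffunP=> y; rewrite sum_ffunE (bigD1 y) //= big1 => [|z nz].
  by rewrite !ffunE eqxx addr0 [RHS]mulr1.
by rewrite !ffunE eq_sym (negPf nz) scaler0.
Qed.

Section Extend.
Variables (V : lmodType k) (phi : G -> V).

Definition gext (f : kG) : V := \sum_x (f x : k) *: phi x.

Fact gext_linear : linear gext.
Proof.
move=> a f g; rewrite scaler_sumr -big_split; apply: eq_bigr => x _ /=.
by rewrite !ffunE scalerDl scalerA.
Qed.
HB.instance Definition _ := GRing.isLinear.Build k kG V *:%R gext gext_linear.

Lemma gextE x : gext (gelt x) = phi x.
Proof.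
rewrite /gext (bigD1 x) //= big1 => [|z nz].
  by rewrite ffunE eqxx scale1r addr0.
by rewrite ffunE (negPf nz) scale0r.
Qed.
End Extend.

Lemma galg_ext (V : lmodType k) (f g : kG -> V) :
  linear f -> linear g -> (forall x, f (gelt x) = g (gelt x)) -> f =1 g.
Proof.
move=> lf lg e h; rewrite [h]gelt_sum.
elim/big_rec: _ => [|x u _ IH]; first by rewrite (lin0 lf) (lin0 lg).
by rewrite lf lg e IH.
Qed.

Definition galg_comul : kG -> kG *t kG := gext (fun x => gelt x *t gelt x).
Definition galg_counit : kG -> k^o := gext (fun _ : G => 1 : k^o).
Definition galg_antipode : kG -> kG := gext (fun x => gelt x^-1%g).

HB.instance Definition _ := GRing.Linear.on galg_comul.
HB.instance Definition _ := GRing.Linear.on galg_counit.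
HB.instance Definition _ := GRing.Linear.on galg_antipode.

Lemma galg_comulE x : galg_comul (gelt x) = gelt x *t gelt x.
Proof. exact: gextE. Qed.
Lemma galg_counitE x : galg_counit (gelt x) = 1.
Proof. exact: gextE. Qed.
Lemma galg_antipodeE x : galg_antipode (gelt x) = gelt x^-1%g.
Proof. exact: gextE. Qed.

Fact galg_comul1 : galg_comul 1 = 1 *t 1.
Proof. exact: galg_comulE. Qed.

Let linP (U V : lmodType k) (f : {linear U -> V}) : linear f := linearP f.

Lemma mulr_lin (g : kG) : linear (fun f : kG => f * g).
Proof. by move=> a f f'; rewrite mulrDl scalerAl. Qed.

Fact galg_comulM f g : galg_comul (f * g) = tmul (galg_comul f) (galg_comul g).
Proof.
move: f; apply: galg_ext => [||x].
- exact: lin_comp (linP _) (mulr_lin g).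
- exact: lin_comp ((tmul_bilinear kG).1 _) (linP _).
move: g; apply: galg_ext => [||y].
- exact: lin_comp (linP _) (mulrl_linear (gelt x)).
- exact: lin_comp ((tmul_bilinear kG).2 _) (linP _).
by rewrite -geltM !galg_comulE tmulE -geltM.
Qed.

Fact galg_counit1 : galg_counit 1 = 1.
Proof. exact: galg_counitE. Qed.

Fact galg_counitM f g : galg_counit (f * g) = (galg_counit f : k) * galg_counit g.
Proof.
move: f; apply: galg_ext => [||x].
- exact: lin_comp (linP _) (mulr_lin g).
- by move=> a f h; rewrite linearP mulrDl; congr (_ + _); apply/esym/mulrA.
move: g; apply: galg_ext => [||y].
- exact: lin_comp (linP _) (mulrl_linear (gelt x)).
- by move=> a f h; rewrite linearP mulrDr; congr (_ + _); apply: mulrCA.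
by rewrite -geltM !galg_counitE mul1r.
Qed.

Fact galg_comulA f :
  tassoc (tmap galg_comul (@idfun kG) (galg_comul f)) =
  tmap (@idfun kG) galg_comul (galg_comul f).
Proof.
move: f; apply: galg_ext => [||x].
- exact: lin_comp (linP _) (lin_comp (linP _) (linP _)).
- exact: lin_comp (linP _) (linP _).
by rewrite galg_comulE !tmapE /= galg_comulE tassocE.
Qed.

Fact galg_counitl f : tlunit (tmap galg_counit (@idfun kG) (galg_comul f)) = f.
Proof.
move: f; apply: (galg_ext _ (@lin_id k kG)) => [|x].
  exact: lin_comp (linP _) (lin_comp (linP _) (linP _)).
by rewrite galg_comulE tmapE tlunitE /= galg_counitE scale1r.
Qed.

Fact galg_counitr f : trunit (tmap (@idfun kG) galg_counit (galg_comul f)) = f.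
Proof.
move: f; apply: (galg_ext _ (@lin_id k kG)) => [|x].
  exact: lin_comp (linP _) (lin_comp (linP _) (linP _)).
by rewrite galg_comulE tmapE trunitE /= galg_counitE scale1r.
Qed.

Fact galg_mul_bilinear : bilinear_for *:%R *:%R ( *%R : kG -> kG -> kG).
Proof. by split=> [g|f]; [apply: mulr_lin|apply: mulrl_linear]. Qed.

Fact galg_unit_lin : linear (fun f : kG => (galg_counit f : k)%:A : kG).
Proof. by move=> a f g; rewrite linearP scalerDl scalerA. Qed.

Fact galg_antipodel f :
  tlift *%R (tmap galg_antipode (@idfun kG) (galg_comul f)) =
  (galg_counit f : k)%:A.
Proof.
move: f; apply: (galg_ext _ galg_unit_lin) => [|x].
  exact: lin_comp (tlift_linear galg_mul_bilinear) (lin_comp (linP _) (linP _)).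
rewrite galg_comulE tmapE (tliftE galg_mul_bilinear) /= galg_antipodeE.
by rewrite galg_counitE -geltM mulVg scale1r.
Qed.

Fact galg_antipoder f :
  tlift *%R (tmap (@idfun kG) galg_antipode (galg_comul f)) =
  (galg_counit f : k)%:A.
Proof.
move: f; apply: (galg_ext _ galg_unit_lin) => [|x].
  exact: lin_comp (tlift_linear galg_mul_bilinear) (lin_comp (linP _) (linP _)).
rewrite galg_comulE tmapE (tliftE galg_mul_bilinear) /= galg_antipodeE.
by rewrite galg_counitE -geltM mulgV scale1r.
Qed.

Definition groupHopf : hopfAlgebra k :=
  @HopfAlgebra k kG galg_comul galg_counit galg_antipode
    galg_comul1 galg_comulM galg_counit1 galg_counitM galg_comulA
    galg_counitl galg_counitr galg_antipodel galg_antipoder.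

End GroupAlgebra.

Definition isocategorical (k : fieldType) (G G' : finGroupType) :=
  monoidally_Morita_equivalent (groupHopf k G) (groupHopf k G').

(* Main.v *)
From Pilot Require Import Defs.
From HB Require Import structures.
From mathcomp Require Import all_boot all_order all_algebra all_fingroup.
From mathcomp Require Import boolp zify cyclic.
Import Pilot.Defs.

Set Implicit Arguments.
Unset Strict Implicit.
Unset Printing Implicit Defensive.

Import GRing.Theory Num.Theory.
Local Open Scope ring_scope.

(** The idea is to find, inside a linear monoidal category, a finite permutation
    whose cycle structure records the orders of the group elements, in such a
    way that a monoidal equivalence conjugates the associated linear operators.

    For an object A put A_0 = A and A_(r+1) = A_r (x) A.  A cyclic form on A is
    a family of linear forms tau_r on Hom(A (x) A_r, A_r (x) A) that does not
    distinguish f o (1 (x) h) from (h (x) 1) o f.  This is the dual of the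
    endomorphism space of A in the tube category of the monoidal category, the
    coend of Hom(A (x) X, X (x) A) over X; the middle object X runs through
    tensor powers of A alone, since over all modules a trace would vanish by
    the Eilenberg swindle.  The tube category has a canonical element at A, the
    Dehn twist, represented by the identity of A (x) A.  Multiplication by it
    sends f to f (x) 1_A, and this gives the operator twist on cyclic forms.
    Only tensor products and the associator enter, no duals and no pivotal
    structure, so a monoidal equivalence F identifies the cyclic forms on A
    with those on F A and respects the twist (the section Transport).

    For a free kG-module A with basis G x S, every cyclic form is a unique
    combination of the forms
      f |-> trace of (x |-> g^-1 . (b-coordinate of f (e_i (x) x))),
    with g in G, with e_i = (1, i) and b two basis elements (combForm_dualLoop,
    combForm_coord), and the twist sends the index (g, i, b) to (g, i, g b).
    So the twist is the operator of a permutation of G x S x (G x S), whose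
    n-th power has cycles of length the order of g^n.

    Two permutations that induce conjugate operators have powers with equally
    many cycles, over any field: the number of cycles is the dimension of the
    space of invariant functions.  For the n-th power this number is
      |S|^2 |G| sum_g 1/#[g^n] = |S|^2 |G| sum_d (N_d / d) gcd (d, n),
    where N_d counts the elements of order d, and the matrix of the gcd(d, n)
    is nonsingular (gcd_combination_eq0).  Hence the numbers |S|^2 |G| N_d are
    invariants; the case d = 1 shows that |S|^2 |G| is one, and the theorem
    follows.

    It remains to find a free module A of finite rank such that F A is free of
    finite rank.  Let R and R' be the regular modules and E a quasi-inverse of
    F.  Since R (x) V is free for each finite-dimensional V, one can take
    A = R (x) E R', for which F A is isomorphic to F R (x) R'.  That E R' and
    F R are finite-dimensional is a consequence of the fact that regular
    modules are finitely generated projective generators (regMod_retract). *)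

(** * Linear categories and equivalences *)

Section LinearCategory.
Variables (k : fieldType) (C : linCategory k).
Implicit Types A B X : C.

Lemma mcompDl A B X (g g' : hom B X) (f : hom A B) :
  (g + g') \mo f = (g \mo f) + (g' \mo f).
Proof. exact: linD ((mcomp_bilinear A B X).1 f) _ _. Qed.

Lemma mcompZl A B X a (g : hom B X) (f : hom A B) :
  (a *: g) \mo f = a *: (g \mo f).
Proof. exact: linZ ((mcomp_bilinear A B X).1 f) a _. Qed.

Lemma mcompDr A B X (g : hom B X) (f f' : hom A B) :
  g \mo (f + f') = (g \mo f) + (g \mo f').
Proof. exact: linD ((mcomp_bilinear A B X).2 g) _ _. Qed.

Lemma mcompZr A B X a (g : hom B X) (f : hom A B) :
  g \mo (a *: f) = a *: (g \mo f).
Proof. exact: linZ ((mcomp_bilinear A B X).2 g) a _. Qed.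

Lemma mcomp0r A B X (g : hom B X) : g \mo (0 : hom A B) = 0.
Proof. exact: lin0 ((mcomp_bilinear A B X).2 g). Qed.

Lemma mcomp_sumr A B X I (s : seq I) (g : hom B X) (f : I -> hom A B) :
  g \mo (\sum_(i <- s) f i) = \sum_(i <- s) (g \mo f i).
Proof.
elim: s => [|i s IH]; first by rewrite !big_nil mcomp0r.
by rewrite !big_cons mcompDr IH.
Qed.

(** Invertibility is a mere existence statement, so the inverse is chosen. *)
Definition minv A B (f : hom A B) : hom B A :=
  if pselect (is_iso f) is left h then projT1 (cid h) else 0.

Lemma minvKl A B (f : hom A B) : is_iso f -> minv f \mo f = idmor A.
Proof. by rewrite /minv; case: pselect => // h _; case: cid => g []. Qed.

Lemma minvKr A B (f : hom A B) : is_iso f -> f \mo minv f = idmor B.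
Proof. by rewrite /minv; case: pselect => // h _; case: cid => g []. Qed.

Lemma iso_monic A B X (f : hom A B) (g g' : hom X A) :
  is_iso f -> f \mo g = f \mo g' -> g = g'.
Proof. by case=> e [ef _] eq; rewrite -[g]mcomp1m -[g']mcomp1m -ef -!mcompA eq. Qed.

Lemma iso_epic A B X (f : hom A B) (g g' : hom B X) :
  is_iso f -> g \mo f = g' \mo f -> g = g'.
Proof. by case=> e [_ fe] eq; rewrite -[g]mcompm1 -[g']mcompm1 -fe !mcompA eq. Qed.

Lemma iso_comp A B X (g : hom B X) (f : hom A B) :
  is_iso g -> is_iso f -> is_iso (g \mo f).
Proof.
case=> g' [g'g gg'] [f' [f'f ff']]; exists (f' \mo g'); split.
  by rewrite mcompA -(mcompA f') g'g mcompm1.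
by rewrite mcompA -(mcompA g) ff' mcompm1.
Qed.

Lemma minv_iso A B (f : hom A B) : is_iso f -> is_iso (minv f).
Proof. by move=> h; exists f; rewrite minvKl ?minvKr. Qed.

Lemma idmor_iso A : is_iso (idmor A).
Proof. by exists (idmor A); rewrite mcomp1m. Qed.

End LinearCategory.

Section LinearFunctor.
Variables (k : fieldType) (C D : linCategory k) (F : linFunctor C D).

Lemma fmap0 A B : fmap F (0 : hom A B) = 0.
Proof. exact: lin0 (@fmap_linear _ _ _ F A B). Qed.

Lemma fmap_sum A B I (s : seq I) (f : I -> hom A B) :
  fmap F (\sum_(i <- s) f i) = \sum_(i <- s) fmap F (f i).
Proof.
elim: s => [|i s IH]; first by rewrite !big_nil fmap0.
by rewrite !big_cons (linD (@fmap_linear _ _ _ F A B)) IH.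
Qed.

End LinearFunctor.

Lemma nat_iso_id_faithful (k : fieldType) (C D : linCategory k)
    (F : linFunctor C D) (G : linFunctor D C) :
  nat_iso (compFunctor G F) (idFunctor C) ->
  forall A B (f g : hom A B), fmap F f = fmap F g -> f = g.
Proof.
case=> eta [eta_iso eta_nat] A B f g eFfg.
apply: (iso_epic (eta_iso A)).
by rewrite -[LHS]eta_nat -[RHS]eta_nat /= eFfg.
Qed.

Lemma nat_iso_id_full (k : fieldType) (C D : linCategory k)
    (F : linFunctor C D) (G : linFunctor D C) :
  nat_iso (compFunctor G F) (idFunctor C) ->
  nat_iso (compFunctor F G) (idFunctor D) ->
  forall A B (f' : hom (F A) (F B)), exists f, fmap F f = f'.
Proof.
move=> hGF hFG A B f'; have [eta [eta_iso eta_nat]] := hGF.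
exists (eta B \mo fmap G f' \mo minv (eta A)).
apply: (nat_iso_id_faithful hFG); apply: (iso_monic (eta_iso B)).
rewrite [LHS](eta_nat _ _ (eta B \mo fmap G f' \mo minv (eta A))) /=.
by rewrite -!mcompA (minvKl (eta_iso A)) mcompm1.
Qed.

(** * Cyclic forms and their twist *)

Section MonoidalCategory.
Variables (k : fieldType) (C : linMonCategory k).
Implicit Types A B X : C.

Lemma thom_iso A A' B B' (f : hom A A') (g : hom B B') :
  is_iso f -> is_iso g -> is_iso (thom f g).
Proof.
case=> f' [f'f ff'] [g' [g'g gg']]; exists (thom f' g').
by rewrite -!thomM f'f ff' g'g gg' !thom1.
Qed.

Variable A : C.

Fixpoint tpow (r : nat) : C := if r is r'.+1 then tobj (tpow r') A else A.

(** The strand A crosses a middle object.  For r = s these represent endomorphisms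
    of A in the tube category; the case r <> s serves to state the relation that
    defines the coend. *)
Definition loop r s := hom (tobj A (tpow r)) (tobj (tpow s) A).

Definition loopform := forall r, loop r r -> k^o.

Definition cyclic_form (tau : loopform) :=
  (forall r, linear (tau r)) /\
  (forall r s (f : loop s r) (h : hom (tpow r) (tpow s)),
     tau r (f \mo thom (idmor A) h) = tau s (thom h (idmor A) \mo f)).

(** A cyclic form is determined by its component at any s such that A_r is a
    retract of a finite sum of copies of A_s. *)
Lemma cyclic_retract (tau : loopform) r s I (e : seq I)
    (u : I -> hom (tpow s) (tpow r)) (v : I -> hom (tpow r) (tpow s)) :
  cyclic_form tau -> \sum_(i <- e) (u i \mo v i) = idmor (tpow r) ->
  forall f, tau r f =
    \sum_(i <- e) tau s (thom (v i) (idmor A) \mo (f \mo thom (idmor A) (u i))).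
Proof.
case=> lin cyc uv f; have lt := (thom_bilinear A A (tpow r) (tpow r)).2 (idmor A).
rewrite -[f in LHS]mcompm1 -thom1 -uv (big_morph _ (linD lt) (lin0 lt)) mcomp_sumr.
rewrite (big_morph _ (linD (lin r)) (lin0 (lin r))); apply: eq_bigr => i _.
by rewrite -[idmor A in LHS]mcomp1m thomM mcompA cyc.
Qed.

(** Composition with the Dehn twist: the strand A is wound once more. *)
Definition wind r s (f : loop r s) : loop r.+1 s.+1 :=
  thom f (idmor A) \mo minv (massoc A (tpow r) A).

Definition twist (tau : loopform) : loopform := fun r f => tau r.+1 (wind f).

End MonoidalCategory.

Arguments twist {k C A} tau r f.

(** * Transport of cyclic forms along a monoidal equivalence *)

Section Transport.
Variables (k : fieldType) (C D : linMonCategory k) (F : linMonFunctor C D).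
Variables (A : C) (B : D) (psi : hom B (F A)).
Hypothesis psi_iso : is_iso psi.
Hypothesis F_faithful : forall X Y (f g : hom X Y), fmap F f = fmap F g -> f = g.
Hypothesis F_full : forall X Y (f' : hom (F X) (F Y)), exists f, fmap F f = f'.

Fixpoint psi_pow r : hom (tpow B r) (F (tpow A r)) :=
  if r is r'.+1 then mon2 F (tpow A r') A \mo thom (psi_pow r') psi else psi.

Lemma psi_pow_iso r : is_iso (psi_pow r).
Proof.
elim: r => //= r IH; apply: iso_comp; first exact: mon2_iso.
exact: thom_iso.
Qed.

Let lam r : hom (tobj B (tpow B r)) (F (tobj A (tpow A r))) :=
  mon2 F A (tpow A r) \mo thom psi (psi_pow r).

Let lam_iso r : is_iso (lam r).
Proof. by apply: iso_comp; [exact: mon2_iso | apply: thom_iso (psi_pow_iso r)]. Qed.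

(** Conjugation of fmap F f by the isomorphisms of B_r with F A_r that are built
    from psi and the monoidal structure of F. *)
Definition loop_map r s (f : loop A r s) : loop B r s :=
  minv (psi_pow s.+1) \mo fmap F f \mo lam r.

Let loop_mapE r s (f : loop A r s) (f' : loop B r s) :
  psi_pow s.+1 \mo f' = fmap F f \mo lam r -> loop_map f = f'.
Proof.
by move=> e; rewrite /loop_map -mcompA -e mcompA (minvKl (psi_pow_iso _)) mcomp1m.
Qed.

Let loop_mapK r s (f : loop A r s) :
  psi_pow s.+1 \mo loop_map f = fmap F f \mo lam r.
Proof.
by rewrite /loop_map !mcompA (minvKr (psi_pow_iso s.+1)) mcomp1m.
Qed.

Lemma loop_map_linear r s : linear (@loop_map r s).
Proof.
move=> a f g; rewrite /loop_map fmap_linear.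
by rewrite mcompDr mcompZr mcompDl mcompZl.
Qed.

Lemma loop_map_inj r s : injective (@loop_map r s).
Proof.
move=> f g e; apply: F_faithful; apply: (iso_epic (lam_iso r)).
by rewrite -!loop_mapK e.
Qed.

Lemma loop_map_surj r s (f' : loop B r s) : exists f, loop_map f = f'.
Proof.
have [f ef] := F_full (psi_pow s.+1 \mo f' \mo minv (lam r)).
exists f; apply: loop_mapE.
by rewrite ef -!mcompA (minvKl (lam_iso r)) mcompm1.
Qed.

Let pow_map r s (h : hom (tpow A r) (tpow A s)) : hom (tpow B r) (tpow B s) :=
  minv (psi_pow s) \mo fmap F h \mo psi_pow r.

Let pow_mapK r s (h : hom (tpow A r) (tpow A s)) :
  psi_pow s \mo pow_map h = fmap F h \mo psi_pow r.
Proof. by rewrite /pow_map !mcompA (minvKr (psi_pow_iso s)) mcomp1m. Qed.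

Let pow_map_surj r s (h' : hom (tpow B r) (tpow B s)) : exists h, pow_map h = h'.
Proof.
have [h eh] := F_full (psi_pow s \mo h' \mo minv (psi_pow r)).
exists h; apply: (iso_monic (psi_pow_iso s)).
by rewrite pow_mapK eh -!mcompA (minvKl (psi_pow_iso r)) mcompm1.
Qed.

Let loop_map_compr r s t (f : loop A s t) (h : hom (tpow A r) (tpow A s)) :
  loop_map (f \mo thom (idmor A) h) = loop_map f \mo thom (idmor B) (pow_map h).
Proof.
apply: loop_mapE; rewrite mcompA loop_mapK fmapM -!mcompA; congr (_ \mo _).
rewrite /lam -thomM mcompm1 pow_mapK [RHS]mcompA -mon2_nat fmap1 -mcompA.
by rewrite -thomM mcomp1m.
Qed.

Let loop_map_compl r s t (f : loop A r s) (h : hom (tpow A s) (tpow A t)) :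
  loop_map (thom h (idmor A) \mo f) = thom (pow_map h) (idmor B) \mo loop_map f.
Proof.
apply: loop_mapE; rewrite mcompA.
have -> : psi_pow t.+1 \mo thom (pow_map h) (idmor B) =
    fmap F (thom h (idmor A)) \mo psi_pow s.+1.
  rewrite /= -mcompA -thomM pow_mapK mcompm1 -[psi in LHS]mcomp1m thomM.
  by rewrite mcompA -(fmap1 F A) mon2_nat mcompA.
by rewrite -mcompA loop_mapK fmapM mcompA.
Qed.

(** The coherence of F with the associators says precisely that F commutes with
    winding. *)
Let loop_map_wind r s (f : loop A r s) : loop_map (wind f) = wind (loop_map f).
Proof.
apply: loop_mapE; rewrite /wind.
apply: (iso_epic (massoc_iso B (tpow B r) B)); rewrite -[RHS]mcompA.
rewrite -[LHS]mcompA -[thom _ _ \mo _ \mo _]mcompA (minvKl (massoc_iso _ _ _)).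
have -> : lam r.+1 \mo massoc B (tpow B r) B =
    fmap F (massoc A (tpow A r) A) \mo (mon2 F _ A \mo thom (lam r) psi).
  transitivity (mon2 F A (tpow A r.+1) \mo thom (idmor (F A)) (mon2 F _ A) \mo
      massoc (F A) (F (tpow A r)) (F A) \mo thom (thom psi (psi_pow r)) psi).
    by rewrite -!mcompA massoc_nat [thom _ _ \mo (thom _ _ \mo _)]mcompA -thomM mcomp1m.
  by rewrite -mon_assoc -!mcompA -thomM mcomp1m.
rewrite mcompm1 [RHS]mcompA -fmapM -[_ \mo massoc _ _ _]mcompA.
rewrite (minvKl (massoc_iso _ _ _)) mcompm1.
transitivity (mon2 F (tpow A s.+1) A \mo thom (fmap F f \mo lam r) psi).
  by rewrite -loop_mapK /= -mcompA -thomM mcompm1.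
by rewrite -[psi in LHS]mcomp1m thomM [LHS]mcompA -(fmap1 F A) mon2_nat -mcompA.
Qed.

Definition pullback (sigma : loopform B) : loopform A :=
  fun r f => sigma r (loop_map f).
Arguments pullback : clear implicits.

Lemma pullback_cyclic sigma : cyclic_form sigma -> cyclic_form (pullback sigma).
Proof.
case=> lin cyc; split=> [r|r s f h]; first exact: lin_comp (lin r) (@loop_map_linear r r).
by rewrite /pullback loop_map_compr loop_map_compl cyc.
Qed.

Lemma pullback_twist sigma r f :
  pullback (twist sigma) r f = twist (pullback sigma) r f.
Proof. by rewrite /pullback /twist loop_map_wind. Qed.

Lemma pullback_inj sigma sigma' :
  (forall r f, pullback sigma r f = pullback sigma' r f) ->
  forall r f, sigma r f = sigma' r f.
Proof. by move=> e r f'; have [f <-] := loop_map_surj f'; apply: e. Qed.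

(** F is full and faithful, so every loop on B and every morphism between the
    powers of B comes from A, and a form on A can be read as a form on B. *)
Lemma pullback_surj tau : cyclic_form tau ->
  exists2 sigma, cyclic_form sigma & forall r f, pullback sigma r f = tau r f.
Proof.
case=> lin cyc; pose sigma r f' := tau r (projT1 (cid (@loop_map_surj r r f'))).
have sigmaE r f : sigma r (loop_map f) = tau r f.
  by rewrite /sigma; case: cid => g /= /loop_map_inj->.
exists sigma => //; split=> [r a f' g'|r s f' h'].
  have [f <-] := loop_map_surj f'; have [g <-] := loop_map_surj g'.
  by rewrite -loop_map_linear !sigmaE lin.
have [f <-] := loop_map_surj f'; have [h <-] := pow_map_surj h'.
by rewrite -loop_map_compr -loop_map_compl !sigmaE cyc.
Qed.

End Transport.

Arguments pullback {k C D F A B} psi sigma r f.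

(** * Dual bases, traces and contractions *)

Section LinearAlgebra.
Variable k : fieldType.
Implicit Types V W U : lmodType k.

(** The vectors span but may be linearly dependent, which makes it easy to pass
    to retracts and tensor products; traces can be computed all the same. *)
Record dualBasis V := DualBasis {
  db_idx : finType;
  db_vec : db_idx -> V;
  db_cov : db_idx -> {linear V -> k^o};
  db_sum : forall v, v = \sum_i (db_cov i v : k) *: db_vec i
}.

Arguments db_vec {V} d i.
Arguments db_cov {V} d i.
Arguments db_sum {V} d v.

Definition trace V (b : dualBasis V) (f : V -> V) : k :=
  \sum_i db_cov b i (f (db_vec b i)).

Lemma eq_trace V (b : dualBasis V) f g : f =1 g -> trace b f = trace b g.
Proof. by move=> e; apply: eq_bigr => i _; rewrite e. Qed.

Lemma traceC V W (b : dualBasis V) (c : dualBasis W)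
    (f : {linear V -> W}) (g : {linear W -> V}) :
  trace b (g \o f) = trace c (f \o g).
Proof.
transitivity (\sum_i \sum_j (db_cov c j (f (db_vec b i)) : k) *
    (db_cov b i (g (db_vec c j)) : k)).
  apply: eq_bigr => i _ /=; rewrite [in LHS](db_sum c (f _)) !linear_sum.
  by apply: eq_bigr => j _; rewrite !linearZ.
rewrite exchange_big; apply: eq_bigr => j _ /=.
rewrite [in RHS](db_sum b (g _)) !linear_sum.
by apply: eq_bigr => i _; rewrite !linearZ mulrC.
Qed.

HB.instance Definition _ V W (v : V) :=
  GRing.isLinear.Build k W (tensor V W) *:%R (tens v) ((tens_bilinear V W).2 v).

Definition contract V W (phi : {linear W -> k^o}) : V *t W -> V :=
  @trunit k V \o tmap idfun phi.
HB.instance Definition _ V W (phi : {linear W -> k^o}) :=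
  GRing.Linear.on (@contract V W phi).

Lemma contractE V W (phi : {linear W -> k^o}) (v : V) w :
  contract phi (v *t w) = (phi w : k) *: v.
Proof. by rewrite /contract /= tmapE trunitE. Qed.

Lemma contractZ V W (phi : {linear W -> k^o}) a (t : V *t W) :
  contract phi (a *: t) = a *: contract phi t.
Proof. exact: linearZ. Qed.

Lemma contract_tmap V V' W W' (phi : {linear W' -> k^o}) (f : {linear V -> V'})
    (g : {linear W -> W'}) (x : V *t W) :
  contract phi (tmap f g x) = f (contract (phi \o g) x).
Proof.
apply: (tens_eq (f := contract phi \o tmap f g)
  (g := f \o contract (phi \o g))) => v w /=.
by rewrite tmapE !contractE linearZ.
Qed.

Section TensorBasis.
Variables (V W : lmodType k) (b : dualBasis V) (c : dualBasis W).

Fact tensor_db_sum (x : V *t W) :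
  x = \sum_p ((db_cov b p.1 \o contract (db_cov c p.2)) x : k) *:
        (db_vec b p.1 *t db_vec c p.2).
Proof.
elim/tens_ind: x => [|v w|x y hx hy].
- by rewrite big1 // => p _; rewrite linear0 scale0r.
- rewrite [LHS](_ : _ = \sum_i \sum_j ((db_cov b i v : k) * (db_cov c j w : k)) *:
      (db_vec b i *t db_vec c j)).
    rewrite pair_bigA; apply: eq_bigr => -[i j] _ /=.
    by rewrite contractE linearZ /= mulrC.
  rewrite {1}(db_sum b v) {1}(db_sum c w).
  rewrite (big_morph (fun v' => v' *t _) (tensDl _) (tens0l _ _)).
  apply: eq_bigr => i _; rewrite tensZl.
  rewrite (big_morph (tens _) (tensDr _) (tens0r _ _)) scaler_sumr.
  by apply: eq_bigr => j _; rewrite tensZr scalerA.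
- rewrite {1}hx {1}hy -big_split; apply: eq_bigr => p _ /=.
  by rewrite !linearD scalerDl.
Qed.

Definition tensorBasis : dualBasis (tensor V W) := DualBasis tensor_db_sum.

(** The partial trace over W of an operator that factors through phi contracts
    the factor W of psi with phi. *)
Lemma trace_tensor (phi : {linear W -> k^o}) (psi : {linear V -> tensor V W})
    (f : V *t W -> V *t W) :
  (forall v w, f (v *t w) = (phi w : k) *: psi v) ->
  trace tensorBasis f = trace b (contract phi \o psi).
Proof.
move=> ef; rewrite /trace /=.
under eq_bigr => p _ do rewrite ef !linearZ /=.
rewrite -(pair_bigA _ (fun i j => (phi (db_vec c j) : k) *
  (db_cov b i (contract (db_cov c j) (psi (db_vec b i))) : k))) /=.
apply: eq_bigr => i _; elim/tens_ind: (psi _) => [|v w|x y hx hy].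
- by rewrite big1 ?linear0 // => j _; rewrite !linear0 mulr0.
- rewrite contractE linearZ /= [in RHS](db_sum c w) linear_sum scaler_suml.
  apply: eq_bigr => j _; rewrite contractE !linearZ /=.
  by rewrite /GRing.scale /= mulrA [X in X * _]mulrC.
- rewrite !linearD -hx -hy -big_split; apply: eq_bigr => j _ /=.
  by rewrite !linearD mulrDr.
Qed.

End TensorBasis.

Definition retractBasis V W (b : dualBasis W) n (u : 'I_n -> {linear W -> V})
    (v : 'I_n -> {linear V -> W}) (uv : forall x, \sum_i u i (v i x) = x) :
  dualBasis V.
Proof.
apply: (@DualBasis V ('I_n * db_idx b)%type (fun p => u p.1 (db_vec b p.2))
  (fun p => db_cov b p.2 \o v p.1)) => x.
rewrite -[LHS]uv -(pair_bigA _ (fun i j =>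
  (db_cov b j (v i x) : k) *: u i (db_vec b j))) /=.
apply: eq_bigr => i _; rewrite [in LHS](db_sum b (v i x)) linear_sum.
by apply: eq_bigr => j _; rewrite linearZ.
Defined.

Definition free_db V (b : dualBasis V) :=
  forall i j, db_cov b i (db_vec b j) = (i == j)%:R.

(** A dual basis presents V as the image of the idempotent matrix
    P = (db_cov j (db_vec i)); a row basis of P gives a basis of V. *)
Lemma exists_free_db V (b : dualBasis V) : exists b' : dualBasis V, free_db b'.
Proof.
pose n := #|db_idx b|; pose e (j : 'I_n) := db_vec b (enum_val j).
pose X x : 'rV[k]_n := \row_l db_cov b (enum_val l) x.
pose E (u : 'rV[k]_n) : V := \sum_l u 0 l *: e l.
have XL : linear X by move=> a x y; apply/rowP=> l; rewrite !mxE linearP.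
have EL : linear E.
  move=> a x y; rewrite scaler_sumr -big_split; apply: eq_bigr => l _ /=.
  by rewrite !mxE scalerDl scalerA.
have EX x : E (X x) = x.
  rewrite [RHS](db_sum b) (reindex_omap enum_val (fun i => Some (enum_rank i))) /=.
    by apply: eq_big => [l|l _]; rewrite ?enum_valK ?eqxx // mxE.
  by move=> i _; rewrite enum_rankK.
pose P : 'M[k]_n := \matrix_j X (e j).
have XE u : X (E u) = u *m P.
  rewrite /E mulmx_sum_row.
  rewrite (big_morph X (linD XL) (lin0 XL)); apply: eq_bigr => l _.
  by rewrite (linZ XL) rowK.
have XP x : X x *m P = X x by rewrite -XE EX.
have PP : P *m P = P.
  by apply/row_matrixP=> j; rewrite row_mul rowK XP.
pose B := row_base P.
have BP : B *m P = B.
  have /submxP[D eB] : (B <= P)%MS by rewrite eq_row_base.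
  by rewrite eB -mulmxA PP.
have cL i : linear (fun x => (X x *m pinvmx B) 0 i : k^o).
  by move=> a x y; rewrite XL mulmxDl -scalemxAl !mxE.
pose c i := HB.pack_for {linear V -> k^o} (fun x => (X x *m pinvmx B) 0 i : k^o)
  (GRing.isLinear.Build k V k^o *:%R _ (cL i)).
have sumB x : x = \sum_i (c i x : k) *: E (row i B).
  rewrite -[LHS]EX -[X x](@mulmxKpV _ _ _ _ _ B); last first.
    by rewrite eq_row_base -XP submxMl.
  rewrite mulmx_sum_row (big_morph E (linD EL) (lin0 EL)).
  by apply: eq_bigr => i _; rewrite (linZ EL).
exists (DualBasis sumB) => i j /=.
rewrite XE -row_mul BP -row_mul mulmxVp ?row_base_free //.
by rewrite !mxE eq_sym.
Qed.

End LinearAlgebra.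

Arguments db_vec {k V} d i.
Arguments db_cov {k V} d i.
Arguments db_sum {k V} d v.

(** * Modules over a group algebra *)

Section GroupModules.
Variables (k : fieldType) (G : finGroupType).
Local Notation H := (groupHopf k G).
Implicit Types (M N : leftModule H) (x y : G).

Definition eltact M x : M -> M := lmact (gelt k x : H).
HB.instance Definition _ M x := GRing.Linear.on (@eltact M x).
Arguments eltact : simpl never.

Lemma eltact1 M (v : M) : eltact 1%g v = v.
Proof. exact: lmact1. Qed.

Lemma eltactM M x y (v : M) : eltact (x * y)%g v = eltact x (eltact y v).
Proof. by rewrite /eltact geltM lmactM. Qed.

Lemma eltactZ M x a (v : M) : eltact x (a *: v) = a *: eltact x v.
Proof. exact: linearZ. Qed.

Lemma eltact_sum M x I (s : seq I) (v : I -> M) :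
  eltact x (\sum_(i <- s) v i) = \sum_(i <- s) eltact x (v i).
Proof. exact: linear_sum. Qed.

Lemma eltactK M x : cancel (@eltact M x) (@eltact M x^-1%g).
Proof. by move=> v; rewrite -eltactM mulVg eltact1. Qed.

Lemma eltactKV M x : cancel (@eltact M x^-1%g) (@eltact M x).
Proof. by move=> v; rewrite -eltactM mulgV eltact1. Qed.

Lemma eltact_tens M N x (v : M) (w : N) :
  eltact x (v *t w : tensorMod M N) = (eltact x v *t eltact x w : tensorMod M N).
Proof. by rewrite /eltact lmactT -[comul _ _]/(galg_comul _) galg_comulE tmapE. Qed.

Lemma eltact_tensor M N x (t : M *t N) :
  eltact x (t : tensorMod M N) = tmap (@eltact M x) (@eltact N x) t.
Proof.
apply: (tens_eq (f := @eltact (tensorMod M N) x)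
  (g := tmap (@eltact M x) (@eltact N x))) => v w.
by rewrite /= tmapE; exact: eltact_tens.
Qed.

Lemma moduleHom_eltact M N (f : moduleHom M N) x v : f (eltact x v) = eltact x (f v).
Proof. exact: moduleHom_act. Qed.

Fact eltHom_subproof M N (f : {linear M -> N}) :
  (forall x v, f (eltact x v) = eltact x (f v)) ->
  forall (a : H) v, f (lmact a v) = lmact a (f v).
Proof.
move=> ef a v; move: a; apply: galg_ext => [||x].
- exact: lin_comp (linearP f) ((lmact_bilinear M).1 v).
- exact: (lmact_bilinear N).1.
- exact: ef.
Qed.

Definition eltHom M N (f : {linear M -> N}) ef : moduleHom M N :=
  mkModuleHom (@eltHom_subproof M N f ef).

Section FromAction.
Variables (V : lmodType k) (rho : G -> V -> V).
Hypotheses (rho_linear : forall x, linear (rho x)) (rho1 : forall v, rho 1%g v = v).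
Hypothesis rhoM : forall x y v, rho (x * y)%g v = rho x (rho y v).

Definition rho_act (a : H) (v : V) : V := gext (rho^~ v) a.

Fact rho_act_bilinear : bilinear_for *:%R *:%R rho_act.
Proof.
split=> [v|a] c u w /=; first exact: (linearP (gext (rho^~ v))).
rewrite /rho_act /gext scaler_sumr -big_split; apply: eq_bigr => x _ /=.
by rewrite rho_linear scalerDr !scalerA [_ * c]mulrC.
Qed.

Fact rho_act1 v : rho_act 1 v = v.
Proof. by rewrite /rho_act gextE. Qed.

Fact rho_actM a b v : rho_act (a * b) v = rho_act a (rho_act b v).
Proof.
have actZ c : linear (rho_act c) by exact: rho_act_bilinear.2.
move: a; apply: galg_ext => [||x].
- apply: (lin_comp (rho_act_bilinear.1 v)); exact: mulr_lin.
- exact: (rho_act_bilinear.1 _).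
move: b; apply: galg_ext => [||y].
- apply: (lin_comp (rho_act_bilinear.1 v)); exact: mulrl_linear.
- exact: lin_comp (actZ _) (rho_act_bilinear.1 v).
by rewrite -[_ * _]/(gelt k x * gelt k y : groupAlg k G) -geltM /rho_act !gextE.
Qed.

Definition actionMod : leftModule H := LeftModule rho_act_bilinear rho_act1 rho_actM.

Lemma eltact_actionMod x (v : V) : eltact x (v : actionMod) = rho x v.
Proof. exact: gextE. Qed.

End FromAction.

(** Freeness as a kG-module on S, presented by a k-basis that G permutes freely
    by left translation. *)
Record freeModule (S : finType) M := FreeModule {
  fbase : G * S -> M;
  fcoord : G * S -> {linear M -> k^o};
  fcoordE : forall p q, fcoord p (fbase q) = (p == q)%:R;
  fbase_sum : forall u, u = \sum_p (fcoord p u : k) *: fbase p;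
  eltact_fbase : forall x p, eltact x (fbase p) = fbase ((x * p.1)%g, p.2)
}.

Section FreeModuleTheory.
Variables (S : finType) (A : leftModule H) (A_free : freeModule S A).
Local Notation fbase := (fbase A_free).
Local Notation fcoord := (fcoord A_free).

Definition freeBasis : dualBasis A := DualBasis (fbase_sum A_free).

Lemma fcoord_eltact x p u : fcoord p (eltact x u) = fcoord ((x^-1 * p.1)%g, p.2) u.
Proof.
rewrite [u in LHS](fbase_sum A_free) [u in RHS](fbase_sum A_free) !linear_sum.
apply: eq_bigr => -[y j] _; rewrite !linearZ /= eltact_fbase !fcoordE.
case: p => z i /=; rewrite !xpair_eqE.
by rewrite -(inj_eq (mulgI x) (x^-1 * z)%g) mulKVg.
Qed.

Lemma freeModule_ext (V : lmodType k) (f g : A -> V) :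
  linear f -> linear g -> (forall p, f (fbase p) = g (fbase p)) -> f =1 g.
Proof.
move=> lf lg e u; rewrite [u](fbase_sum A_free).
elim/big_rec: _ => [|p v _ IH]; first by rewrite (lin0 lf) (lin0 lg).
by rewrite lf lg e IH.
Qed.

Section FreeHom.
Variables (M : leftModule H) (m : S -> M).

Definition free_ext (u : A) : M :=
  \sum_p (fcoord p u : k) *: eltact p.1 (m p.2).

Fact free_ext_linear : linear free_ext.
Proof.
move=> a u v; rewrite scaler_sumr -big_split; apply: eq_bigr => p _ /=.
by rewrite linearP scalerDl scalerA.
Qed.
HB.instance Definition _ :=
  GRing.isLinear.Build k A M *:%R free_ext free_ext_linear.

Lemma free_extE p : free_ext (fbase p) = eltact p.1 (m p.2).
Proof.
rewrite /free_ext (bigD1 p) //= big1 => [|q nq].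
  by rewrite fcoordE eqxx scale1r addr0.
by rewrite fcoordE (negPf nq) scale0r.
Qed.

Fact free_ext_eltact x u : free_ext (eltact x u) = eltact x (free_ext u).
Proof.
move: u; apply: freeModule_ext => [||p].
- by move=> a u v; rewrite !linearP.
- by move=> a u v; rewrite !linearP.
by rewrite eltact_fbase !free_extE eltactM.
Qed.

Definition freeHom : moduleHom A M := eltHom free_ext_eltact.

Lemma freeHomE p : freeHom (fbase p) = eltact p.1 (m p.2).
Proof. exact: free_extE. Qed.
End FreeHom.

Lemma freeHom_ext (M : leftModule H) (f g : moduleHom A M) :
  (forall j, f (fbase (1%g, j)) = g (fbase (1%g, j))) -> f = g.
Proof.
move=> e; apply: moduleHomP; apply: freeModule_ext;
  [exact: (moduleHom_linear f) | exact: (moduleHom_linear g) |].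
case=> y j; have -> : fbase (y, j) = eltact y (fbase (1%g, j)).
  by rewrite eltact_fbase mulg1.
by rewrite !moduleHom_eltact e.
Qed.

End FreeModuleTheory.

(** The group algebra as a left module, on functions on G * unit so that its
    standard basis has the shape required by freeModule. *)
Section RegularModule.

Local Notation funs := {ffun G * unit -> k^o}.

Definition translate x (u : funs) : funs := [ffun p => u (x^-1 * p.1, p.2)%g].

Fact translate_linear x : linear (translate x).
Proof. by move=> a u v; apply/ffunP=> p; rewrite !ffunE. Qed.

Fact translate1 u : translate 1%g u = u.
Proof. by apply/ffunP=> -[y j]; rewrite ffunE /= invg1 mul1g. Qed.

Fact translateM x y u : translate (x * y)%g u = translate x (translate y u).
Proof. by apply/ffunP=> p; rewrite !ffunE /= invMg mulgA. Qed.

Definition regMod : leftModule H :=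
  actionMod translate_linear translate1 translateM.

Definition reg_base (p : G * unit) : regMod := ([ffun q => (q == p)%:R] : funs).

Definition reg_coord (p : G * unit) (u : regMod) : k^o := (u : funs) p.
Fact reg_coord_linear p : linear (reg_coord p).
Proof. by move=> a u v; rewrite /reg_coord !ffunE. Qed.
HB.instance Definition _ p :=
  GRing.isLinear.Build k regMod k^o *:%R (reg_coord p) (reg_coord_linear p).

Fact reg_coordE p q : reg_coord p (reg_base q) = (p == q)%:R.
Proof. by rewrite /reg_coord ffunE. Qed.

Fact reg_base_sum u : u = \sum_p (reg_coord p u : k) *: reg_base p.
Proof.
apply/ffunP=> q; rewrite sum_ffunE (bigD1 q) //= big1 => [|p nq].
  by rewrite !ffunE eqxx addr0 [RHS]mulr1.
by rewrite !ffunE eq_sym (negPf nq) scaler0.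
Qed.

Fact eltact_reg_base x p : eltact x (reg_base p) = reg_base ((x * p.1)%g, p.2).
Proof.
rewrite eltact_actionMod; apply/ffunP=> -[y j]; rewrite !ffunE /=; case: p => z i.
by rewrite /= !xpair_eqE -(inj_eq (mulgI x)) mulKVg.
Qed.

Definition regMod_free : freeModule unit regMod :=
  @FreeModule unit regMod reg_base (fun p => reg_coord p) reg_coordE reg_base_sum
    eltact_reg_base.

End RegularModule.

End GroupModules.

(* On a tensor product the action would reduce to its definition by comul. *)
Arguments eltact {k G M} x v : simpl never.

(** * Traces of slices of a loop *)

Section FreeLoops.
Variables (k : fieldType) (G : finGroupType) (S : finType).
Local Notation H := (groupHopf k G).
Variables (A : leftModule H) (A_free : freeModule S A).
Local Notation e i := (fbase A_free (1%g, i)).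
Local Notation fbase := (fbase A_free).
Local Notation fcoord := (fcoord A_free).
Implicit Types (X Y N : leftModule H) (g x y z : G) (i j l : S) (b p q : G * S).

Lemma tensor_free_ext X N (f f' : moduleHom (tensorMod A X) N) :
  (forall i u, f (e i *t u) = f' (e i *t u)) -> f = f'.
Proof.
move=> ef; apply: moduleHomP; apply: (@tens_ext k A X N);
  [exact: (moduleHom_linear f) | exact: (moduleHom_linear f') |].
move=> v u; move: v.
refine (@freeModule_ext k G S A A_free N (fun v => f (v *t u))
  (fun v => f' (v *t u)) _ _ _) => [||[y i]].
- exact: lin_comp (moduleHom_linear f) ((tens_bilinear A X).1 u).
- exact: lin_comp (moduleHom_linear f') ((tens_bilinear A X).1 u).
have -> : fbase (y, i) *t u = eltact y (e i *t eltact y^-1%g u : tensorMod A X).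
  by rewrite eltact_tens eltact_fbase mulg1 eltactKV.
by rewrite !moduleHom_eltact ef.
Qed.

Lemma contract_eltact X p x (t : tensorMod X A) :
  contract (fcoord p) (eltact x t) =
  eltact x (contract (fcoord ((x^-1 * p.1)%g, p.2)) t).
Proof.
apply: etrans (congr1 (contract (fcoord p)) (@eltact_tensor k G X A x t)) _.
rewrite contract_tmap; congr (eltact _ (trunit _)); apply: eq_tmap => // v.
exact: fcoord_eltact.
Qed.

(** A loop f : A (x) Y -> X (x) A cuts down to a linear map Y -> X by entering
    with the basis vector (1, i) on the strand A and leaving with the basis
    vector b; the factor g^-1 absorbs the translation that f effects on X. *)
Section Slice.
Variables (X Y : leftModule H) (g : G) (i : S) (b : G * S).
Variable f : moduleHom (tensorMod A Y) (tensorMod X A).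

Definition slice (u : Y) : X :=
  eltact g^-1%g (contract (fcoord b) (f (e i *t u) : X *t A)).

Fact slice_linear : linear slice.
Proof.
exact: lin_comp (linearP (@eltact k G X g^-1%g)) (lin_comp (linearP (contract _))
  (lin_comp (moduleHom_linear f) ((tens_bilinear A Y).2 (e i)))).
Qed.
HB.instance Definition _ := GRing.isLinear.Build k Y X *:%R slice slice_linear.
End Slice.

(** The cyclicity of the trace is that of the form: h commutes with g^-1. *)
Lemma trace_sliceC X Y (bX : dualBasis X) (bY : dualBasis Y) g i b
    (f : moduleHom (tensorMod A Y) (tensorMod X A)) (h : moduleHom X Y) :
  trace bX (slice g i b (compHom f (tensorHom (idHom A) h))) =
  trace bY (slice g i b (compHom (tensorHom h (idHom A)) f)).
Proof.
transitivity (trace bX (slice g i b f \o h)).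
  by apply: eq_trace => u; rewrite /slice /= tmapE.
rewrite (traceC bX bY h (slice g i b f)); apply: eq_trace => u.
by rewrite /slice /= contract_tmap moduleHom_eltact.
Qed.

Definition assocInv X Y N :
    moduleHom (tensorMod X (tensorMod Y N)) (tensorMod (tensorMod X Y) N) :=
  minv (massoc (X : Mod H) Y N).

Lemma assocInvE X Y N t : assocInv X Y N t = tassoc_inv t.
Proof.
have e : tassoc (assocInv X Y N t) = t :=
  congr1 (fun f : moduleHom _ _ => f t) (minvKr (massoc_iso (X : Mod H) Y N)).
exact: etrans (esym (@tassocK k X Y N _)) (congr1 (@tassoc_inv k X Y N) e).
Qed.

(** The wound loop sends e_i (x) (x (x) v) to f (e_i (x) x) (x) v: the strand that
    leaves is the old last factor v, and what f emits on A is the new last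
    factor.  The trace over this factor identifies the two, so that the
    b-coordinate is read after the translation by g^-1. *)
Lemma trace_slice_wind X (bX : dualBasis X) g i b
    (f : moduleHom (tensorMod A X) (tensorMod X A)) :
  trace (tensorBasis bX (freeBasis A_free))
    (slice g i b (compHom (tensorHom f (idHom A)) (assocInv A X A))) =
  trace bX (slice g i ((g * b.1)%g, b.2) f).
Proof.
pose psi : {linear X -> tensor X A} :=
  @eltact k G (tensorMod X A) g^-1%g \o f \o tens (e i).
transitivity (trace bX (contract (fcoord b) \o psi)).
  pose F := slice g i b (compHom (tensorHom f (idHom A)) (assocInv A X A)).
  apply: (@trace_tensor k X A bX (freeBasis A_free) (fcoord b) psi F) => u v.
  have ef : compHom (tensorHom f (idHom A)) (assocInv A X A)
      (e i *t (u *t v : tensorMod X A)) = f (e i *t u) *t v.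
    rewrite /= assocInvE; apply: etrans (tmapE f (@idfun A) _ _).
    exact: congr1 (tassoc_invE _ _ _).
  by rewrite /F /slice ef contractE linearZ.
by apply: eq_trace => u; rewrite /= contract_eltact invgK.
Qed.

End FreeLoops.

(** * Elementary loops *)

Section ElementaryLoops.
Variables (k : fieldType) (G : finGroupType) (S : finType).
Local Notation H := (groupHopf k G).
Variables (A : leftModule H) (A_free : freeModule S A).
Local Notation e i := (fbase A_free (1%g, i)).
Local Notation fbase := (fbase A_free).
Local Notation fcoord := (fcoord A_free).
Implicit Types (X Y N V : leftModule H) (g x y z : G) (i j l : S) (b p q : G * S).

Lemma tensor_base_ext N (f f' : moduleHom (tensorMod A A) N) :
  (forall i p, f (e i *t fbase p) = f' (e i *t fbase p)) -> f = f'.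
Proof.
move=> ef; apply: (tensor_free_ext (A_free := A_free)) => i u; move: u.
refine (@freeModule_ext k G S A A_free N (fun u => f (e i *t u))
  (fun u => f' (e i *t u)) _ _ (ef i)).
  exact: lin_comp (moduleHom_linear f) ((tens_bilinear A A).2 (e i)).
exact: lin_comp (moduleHom_linear f') ((tens_bilinear A A).2 (e i)).
Qed.

Lemma moduleHom_sumE (X Y : leftModule H) I (s : seq I) (f : I -> moduleHom X Y)
    (u : X) : (\sum_(i <- s) f i) u = \sum_(i <- s) f i u.
Proof. by elim/big_rec2: _ => // i _ h _ <-. Qed.

Lemma moduleHom_scaleE (X Y : leftModule H) a (f : moduleHom X Y) (u : X) :
  (a *: f) u = a *: f u.
Proof. by []. Qed.

Definition coord2 p q : A *t A -> k^o := fcoord p \o contract (fcoord q).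
HB.instance Definition _ p q := GRing.Linear.on (coord2 p q).

Lemma coord2E p q p' q' :
  coord2 p q (fbase p' *t fbase q') = ((p == p') && (q == q'))%:R.
Proof.
by rewrite /coord2 /= contractE linearZ !fcoordE /= -[_ *: _]natrM mulnb andbC.
Qed.

Lemma coord2_eltact p q x (t : tensorMod A A) :
  coord2 p q (eltact x t) =
  coord2 ((x^-1 * p.1)%g, p.2) ((x^-1 * q.1)%g, q.2) t.
Proof. by rewrite /coord2 /= contract_eltact fcoord_eltact. Qed.

(** The equivariant matrix units: the loop that sends (1, i) (x) q to q' (x) b
    and kills the other vectors (1, i') (x) p. *)
Section Elementary.
Variables (i : S) (q q' b : G * S).

Definition elem_fun (t : tensorMod A A) : tensorMod A A :=
  \sum_z (coord2 (z, i) ((z * q.1)%g, q.2) t : k) *: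
    eltact z (fbase q' *t fbase b : tensorMod A A).

Fact elem_linear : linear elem_fun.
Proof.
move=> a t u; rewrite scaler_sumr -big_split; apply: eq_bigr => z _ /=.
by rewrite (linearP (coord2 _ _)) scalerDl scalerA.
Qed.
HB.instance Definition _ :=
  GRing.isLinear.Build k (tensorMod A A) (tensorMod A A) *:%R elem_fun elem_linear.

Fact elem_eltact x (t : tensorMod A A) :
  elem_fun (eltact x t) = eltact x (elem_fun t).
Proof.
rewrite [RHS]eltact_sum.
rewrite [LHS](reindex_inj (mulgI x)); apply: eq_bigr => z _ /=.
rewrite eltactZ -eltactM.
by rewrite coord2_eltact /= mulKg -mulgA mulKg.
Qed.

Definition elem : moduleHom (tensorMod A A) (tensorMod A A) :=
  eltHom (M := tensorMod A A) (N := tensorMod A A) (f := elem_fun) elem_eltact.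

Lemma elemE i' p :
  elem (e i' *t fbase p) =
  (((i == i') && (q == p))%:R : k) *: (fbase q' *t fbase b).
Proof.
rewrite /= /elem_fun (bigD1 1%g) //= big1 => [|z nz].
  by rewrite addr0 coord2E mul1g -surjective_pairing eltact1 xpair_eqE eqxx.
by rewrite coord2E xpair_eqE (negPf nz) scale0r.
Qed.
End Elementary.

Lemma elem_sum (f : moduleHom (tensorMod A A) (tensorMod A A)) :
  f = \sum_(w : (S * (G * S)) * ((G * S) * (G * S)))
    (coord2 w.2.1 w.2.2 (f (e w.1.1 *t fbase w.1.2)) : k) *:
    elem w.1.1 w.1.2 w.2.1 w.2.2.
Proof.
apply: tensor_base_ext => i p; rewrite moduleHom_sumE.
under [RHS]eq_bigr => w _ do rewrite moduleHom_scaleE elemE -xpair_eqE.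
rewrite -(pair_bigA _ (fun w1 w2 =>
  (coord2 w2.1 w2.2 (f (e w1.1 *t fbase w1.2)) : k) *:
    ((((w1.1, w1.2) == (i, p))%:R : k) *: (fbase w2.1 *t fbase w2.2)))) /=.
rewrite (bigD1 (i, p)) //= [X in _ + X]big1 => [|[j q] /= njq].
  rewrite addr0.
  rewrite [LHS](db_sum (tensorBasis (freeBasis A_free) (freeBasis A_free))).
  by apply: eq_bigr => w _; rewrite eqxx scale1r.
by rewrite big1 // => w _; rewrite (negPf njq) scale0r scaler0.
Qed.

Lemma slice_elem g i i' q q' b b' p :
  slice A_free g i b (elem i' q q' b') (fbase p) =
  ([&& i' == i, q == p & b == b']%:R : k) *: eltact g^-1%g (fbase q').
Proof.
have cE (a : k) : contract (fcoord b) (a *: (fbase q' *t fbase b')) =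
    (a * (b == b')%:R) *: fbase q'.
  by rewrite contractZ contractE fcoordE scalerA.
apply: etrans (congr1 (fun t => eltact g^-1%g (contract (fcoord b) t))
  (elemE _ _ _ _ _ _)) _.
by rewrite cE eltactZ -natrM mulnb andbA.
Qed.

(** Untwisting the diagonal action turns V (x) A into a sum of copies of A indexed
    by a basis of V; a dual basis presents it as a retract of such a sum. *)
Lemma retract_tensor V (c : dualBasis V) :
  exists (u : db_idx c -> moduleHom A (tensorMod V A))
    (v : db_idx c -> moduleHom (tensorMod V A) A),
    \sum_i compHom (u i) (v i) = idHom (tensorMod V A).
Proof.
pose cf s p : V *t A -> k^o :=
  db_cov c s \o @eltact k G V p.1^-1%g \o contract (fcoord p).
have cfL s p : linear (cf s p).
  exact: lin_comp (linearP _) (lin_comp (linearP _) (linearP _)).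
pose vf s (t : tensorMod V A) : A := \sum_p (cf s p t : k) *: fbase p.
have vL s : linear (vf s).
  move=> a t w; rewrite scaler_sumr -big_split; apply: eq_bigr => p _ /=.
  by rewrite cfL scalerDl scalerA.
pose vl s := HB.pack_for {linear tensorMod V A -> A} (vf s)
  (GRing.isLinear.Build k (tensorMod V A) A *:%R (vf s) (vL s)).
have vG s x (t : tensorMod V A) : vl s (eltact x t) = eltact x (vl s t).
  rewrite [RHS]eltact_sum.
  have bij : bijective (fun p : G * S => ((x * p.1)%g, p.2)).
    by exists (fun p => ((x^-1 * p.1)%g, p.2)) => -[y j] /=; rewrite ?mulKg ?mulKVg.
  rewrite [LHS](reindex _ (onW_bij _ bij)); apply: eq_bigr => -[y j] _ /=.
  rewrite eltactZ eltact_fbase; congr (_ *: _).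
  rewrite /cf /= contract_eltact /= -eltactM mulKg.
  by rewrite invMg -mulgA mulVg mulg1.
pose us s := freeHom A_free (M := tensorMod V A) (fun j => db_vec c s *t e j).
exists us,
  (fun s => eltHom (M := tensorMod V A) (N := A) (vG s)).
apply: moduleHomP.
set F := \sum_s _.
refine (@tens_ext k V A (tensorMod V A) F idfun (moduleHom_linear F) (@lin_id _ _) _)
  => w u; move: u.
refine (@freeModule_ext k G S A A_free (tensorMod V A) (fun u => F (w *t u))
  (fun u => w *t u) _ _ _) => [||[g j]].
- exact: lin_comp (moduleHom_linear F) ((tens_bilinear V A).2 w).
- exact: (tens_bilinear V A).2 w.
have uE s : us s (fbase (g, j)) = eltact g (db_vec c s) *t fbase (g, j).
  by apply: etrans (freeHomE _ _ _) _; rewrite eltact_tens eltact_fbase /= mulg1.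
have cfE s p : cf s p (w *t fbase (g, j)) =
    ((p == (g, j))%:R : k) *: db_cov c s (eltact g^-1%g w).
  rewrite /cf /= contractE fcoordE eltactZ linearZ /=.
  by case: eqP => [->|_] //; rewrite !scale0r.
have vE s : vl s (w *t fbase (g, j)) =
    (db_cov c s (eltact g^-1%g w) : k) *: fbase (g, j).
  rewrite /= /vf (bigD1 (g, j)) //= big1 ?addr0 => [|p np].
    by rewrite cfE eqxx scale1r.
  by rewrite cfE (negPf np) !scale0r.
rewrite /F moduleHom_sumE.
transitivity (eltact g (\sum_s (db_cov c s (eltact g^-1%g w) : k) *: db_vec c s)
    *t fbase (g, j)); last by rewrite -(db_sum c) eltactKV.
rewrite eltact_sum (big_morph (fun v => v *t fbase (g, j)) (tensDl _) (tens0l _ _)).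
apply: eq_bigr => s _; rewrite eltactZ tensZl.
apply: etrans (congr1 (us s) (vE s)) _.
by apply: etrans (linearZ_LR (us s) _ _) _; congr (_ *: _); apply: uE.
Qed.

End ElementaryLoops.

(** * Cyclic forms on a free module *)

Section CyclicForms.
Variables (k : fieldType) (G : finGroupType) (S : finType).
Local Notation H := (groupHopf k G).
Variables (A : leftModule H) (A_free : freeModule S A) (s0 : S).
Local Notation e i := (fbase A_free (1%g, i)).
Local Notation fbase := (fbase A_free).
Local Notation MA := (A : Mod H).
Local Notation elem := (elem A_free).

(** A triple (g, i, b) names the slice that enters at (1, i), leaves at b and is
    translated back by g. *)
Definition loopIdx := (G * S * (G * S))%type.
Implicit Types (y : loopIdx) (t : {ffun loopIdx -> k^o}).

Fixpoint powBasis r : dualBasis (tpow MA r : leftModule H) :=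
  if r is r'.+1 then tensorBasis (powBasis r') (freeBasis A_free)
  else freeBasis A_free.

Definition sliceForm y : loopform MA := fun r f =>
  trace (powBasis r) (slice A_free y.1.1 y.1.2 y.2 f).
Arguments sliceForm : clear implicits.

Lemma sliceForm_cyclic y : cyclic_form (sliceForm y).
Proof.
split=> [r a f f'|r s f h]; last first.
  exact: (@trace_sliceC k G S A A_free (tpow MA r) (tpow MA s)).
rewrite /sliceForm /trace scaler_sumr -big_split; apply: eq_bigr => u _ /=.
rewrite -(linearP (db_cov _ _)); congr (db_cov _ _ _).
by rewrite /slice -(linearP (@eltact k G _ _)) -linearP.
Qed.

Definition turn y : loopIdx := (y.1, ((y.1.1^-1 * y.2.1)%g, y.2.2)).
Definition unturn y : loopIdx := (y.1, ((y.1.1 * y.2.1)%g, y.2.2)).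

Lemma turnK : cancel turn unturn.
Proof. by case=> [[g i] [z j]]; rewrite /turn /unturn /= mulKVg. Qed.

Lemma unturnK : cancel unturn turn.
Proof. by case=> [[g i] [z j]]; rewrite /turn /unturn /= mulKg. Qed.

Lemma sliceForm_twist y r f : twist (sliceForm y) r f = sliceForm (unturn y) r f.
Proof. exact: (@trace_slice_wind k G S A A_free (tpow MA r)). Qed.

Definition combForm t : loopform MA := fun r f =>
  \sum_y (t y : k) *: (sliceForm y r f : k^o).
Arguments combForm : clear implicits.

Lemma combForm_cyclic t : cyclic_form (combForm t).
Proof.
split=> [r a f f'|r s f h]; last first.
  by apply: eq_bigr => y _; rewrite (sliceForm_cyclic y).2.
rewrite /combForm scaler_sumr -big_split; apply: eq_bigr => y _ /=.
by rewrite (sliceForm_cyclic y).1 scalerDr !scalerA [_ * a]mulrC.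
Qed.

Lemma combForm_linear r f : linear (fun t => combForm t r f).
Proof.
move=> a t t'; rewrite /combForm scaler_sumr -big_split; apply: eq_bigr => y _ /=.
by rewrite !ffunE scalerDl scalerA.
Qed.

Lemma combForm_twist t r f :
  twist (combForm t) r f = combForm [ffun y => t (turn y)] r f.
Proof.
rewrite [RHS](reindex unturn) /=; last first.
  by exists turn => y _; [apply: unturnK|apply: turnK].
by apply: eq_bigr => y _; rewrite ffunE unturnK -sliceForm_twist.
Qed.

(** One index s0 is enough: endomorphisms of A move every basis vector to (1, s0),
    and a cyclic form sees only the total effect of such moves. *)
Definition dualLoop y : loop MA 0 0 := elem y.1.2 (1%g, s0) (y.1.1, s0) y.2.

Lemma sliceForm_dualLoop y y' : sliceForm y 0 (dualLoop y') = (y == y')%:R.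
Proof.
case: y y' => [[g i] b] [[g' i'] b'].
rewrite /sliceForm /trace /=.
under eq_bigr => p _ do rewrite slice_elem linearZ eltact_fbase fcoordE /=.
rewrite (bigD1 (1%g, s0)) //= big1 => [|p np].
  rewrite addr0 eqxx /= -[_ *: _]natrM mulnb !xpair_eqE eqxx andbT; congr (_%:R).
  rewrite -(inj_eq (mulgI g)) mulg1 mulKVg [i' == i]eq_sym.
  by case: (i == i'); case: (g == g'); case: (b == b').
by rewrite [_ == p]eq_sym (negPf np) andbF scale0r.
Qed.

(** An elementary loop factors through the endomorphism h of A that moves the
    basis vector (x, j) to (1, s0); cyclicity moves h to the other end. *)
Lemma elem_dualLoop (tau : loopform MA) i (x : G) j (y : G) l b : cyclic_form tau ->
  tau 0 (elem i (x, j) (y, l) b) =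
  ((l == j)%:R : k) *: tau 0 (dualLoop ((y * x^-1)%g, i, b)).
Proof.
case=> lin cyc.
pose h : moduleHom A A := freeHom A_free
  (fun l' => ((l' == j)%:R : k) *: fbase (x^-1%g, s0)).
have hE z l' : h (fbase (z, l')) = ((l' == j)%:R : k) *: fbase ((z * x^-1)%g, s0).
  by rewrite freeHomE /= eltactZ eltact_fbase.
pose f0 := elem i (1%g, s0) (y, l) b.
have e1 : elem i (x, j) (y, l) b = compHom f0 (tensorHom (idHom A) h).
  apply: (tensor_base_ext (A_free := A_free)) => i' [z l'].
  apply: etrans (elemE _ _ _ _ _ _ _) _; apply: esym.
  apply: etrans (congr1 f0 (tmapE (@idfun A) h _ _)) _.
  apply: etrans (congr1 (fun w => f0 (e i' *t w)) (hE z l')) _.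
  rewrite tensZr (linZ (moduleHom_linear f0)) elemE scalerA -natrM mulnb.
  rewrite !xpair_eqE eqxx andbT [l' == j]eq_sym [1%g == _]eq_sym -eq_mulgV1.
  by rewrite [z == x]eq_sym andbCA [X in _ && X]andbC.
have e2 : compHom (tensorHom h (idHom A)) f0 =
   ((l == j)%:R : k) *: (dualLoop ((y * x^-1)%g, i, b) : moduleHom _ _).
  apply: (tensor_base_ext (A_free := A_free)) => i' p.
  apply: etrans (congr1 (tensorHom h (idHom A)) (elemE _ _ _ _ _ _ _)) _.
  apply: etrans (linearZ_LR (tensorHom h (idHom A)) _ _) _.
  rewrite moduleHom_scaleE [in RHS]elemE; apply: esym; rewrite scalerA mulrC -scalerA.
  congr (_ *: _); apply: esym; apply: etrans (tmapE h (@idfun A) _ _) _.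
  by apply: etrans (congr1 (fun w => w *t _) (hE y l)) _; rewrite tensZl.
rewrite e1 [LHS](cyc 0 0 f0 h) [X in tau 0 X]e2.
exact: linZ (lin 0) _ _.
Qed.

(** In level 0 every loop is a combination of elementary loops; in level r + 1
    the identity of A_(r+1) factors through copies of A. *)
Lemma cyclic_ext (tau tau' : loopform MA) : cyclic_form tau -> cyclic_form tau' ->
  (forall y, tau 0 (dualLoop y) = tau' 0 (dualLoop y)) ->
  forall r f, tau r f = tau' r f.
Proof.
move=> cyc cyc' eq0.
have eq1 (f : loop MA 0 0) : tau 0 f = tau' 0 f.
  rewrite [f](elem_sum A_free).
  rewrite (big_morph (tau 0) (linD (cyc.1 0)) (lin0 (cyc.1 0))).
  rewrite (big_morph (tau' 0) (linD (cyc'.1 0)) (lin0 (cyc'.1 0))).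
  apply: eq_bigr => -[[i [x j]] [[y l] b]] _ /=.
  rewrite (linZ (cyc.1 0)) (linZ (cyc'.1 0)); congr (_ *: _).
  by rewrite (elem_dualLoop _ _ _ _ _ _ cyc) (elem_dualLoop _ _ _ _ _ _ cyc') eq0.
case=> [|r] f; first exact: eq1.
have [u [v uv]] := retract_tensor A_free (powBasis r).
have expand sigma (c : cyclic_form sigma) := @cyclic_retract k (Mod H) MA sigma
  r.+1 0 _ (index_enum (db_idx (powBasis r))) u v c uv f.
by rewrite (expand _ cyc) (expand _ cyc'); apply: eq_bigr => s _; apply: eq1.
Qed.

Definition loopCoord (tau : loopform MA) : {ffun loopIdx -> k^o} :=
  [ffun y => tau 0 (dualLoop y)].

Lemma combForm_dualLoop t y : combForm t 0 (dualLoop y) = t y.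
Proof.
rewrite /combForm (bigD1 y) //= big1 => [|y' ny].
  by rewrite sliceForm_dualLoop eqxx addr0 [LHS]mulr1.
by rewrite sliceForm_dualLoop (negPf ny) scaler0.
Qed.

Lemma combForm_coord tau r f : cyclic_form tau -> combForm (loopCoord tau) r f = tau r f.
Proof.
move=> cyc; apply: (cyclic_ext (combForm_cyclic _) cyc) => y.
by rewrite combForm_dualLoop ffunE.
Qed.

End CyclicForms.

Arguments sliceForm {k G S A} A_free y r f.
Arguments combForm {k G S A} A_free t r f.

(** * Linearly conjugate permutations *)

Section PermutationModules.
Variable k : fieldType.

Lemma ffun_inj_leq_card (O O' : finType) (L : {ffun O -> k^o} -> {ffun O' -> k^o}) :
  linear L -> injective L -> (#|O| <= #|O'|)%N.
Proof.
move=> lin inj.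
pose vec (u : 'rV[k]_#|O|) : {ffun O -> k^o} := [ffun o => u 0 (enum_rank o)].
pose M := \matrix_(i < #|O|, j < #|O'|)
  (L [ffun o => (o == enum_val i)%:R] (enum_val j) : k).
have eM u j : (u *m M) 0 j = L (vec u) (enum_val j).
  have -> : vec u = \sum_i (u 0 i : k) *: [ffun o => (o == enum_val i)%:R].
    apply/ffunP=> o; rewrite sum_ffunE ffunE (bigD1 (enum_rank o)) //= big1.
      by rewrite !ffunE enum_rankK eqxx addr0 [RHS]mulr1.
    move=> i ni; rewrite !ffunE (_ : _ == _ = false) ?scaler0 //.
    by apply: contraNF ni => /eqP->; rewrite enum_valK.
  rewrite (big_morph L (linD lin) (lin0 lin)) sum_ffunE mxE.
  by apply: eq_bigr => i _; rewrite (linZ lin) !ffunE mxE.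
(* The rows of M are the images of the standard basis of functions. *)
have /eqP <- : row_free M.
  apply: inj_row_free => u u0.
  have : vec u = 0.
    apply: inj; rewrite (lin0 lin); apply/ffunP=> o'.
    by rewrite -[o']enum_rankK -eM u0 mxE ffunE.
  move/ffunP=> v0; apply/rowP=> i.
  by have := v0 (enum_val i); rewrite !ffunE enum_valK mxE.
exact: rank_leq_col.
Qed.

Variables (Y Y' : finType).

(** L embeds the functions constant on the cycles of s' into those constant on
    the cycles of s. *)
Lemma intertwine_leq_porbits (s : {perm Y}) (s' : {perm Y'})
    (L : {ffun Y' -> k^o} -> {ffun Y -> k^o}) :
  linear L -> injective L ->
  (forall t : {ffun Y' -> k^o}, L [ffun y => t (s' y)] = [ffun y => L t (s y)]) ->
  (#|porbits s'| <= #|porbits s|)%N.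
Proof.
move=> lin inj comm.
pose O := {o | o \in porbits s}; pose O' := {o | o \in porbits s'}.
have orb y : porbit s y \in porbits s by apply: imset_f.
have orb' y : porbit s' y \in porbits s' by apply: imset_f.
pose cls y : O := exist _ (porbit s y) (orb y).
pose cls' y : O' := exist _ (porbit s' y) (orb' y).
pose ext (u : {ffun O' -> k^o}) : {ffun Y' -> k^o} :=
  [ffun y => u (cls' y)].
have pt (o : O) : {y | porbit s y = val o}.
  by apply/cid; case: o => o /= /imsetP[y _ ->]; exists y.
have pt' (o : O') : {y | porbit s' y = val o}.
  by apply/cid; case: o => o /= /imsetP[y _ ->]; exists y.
pose res (t : {ffun Y -> k^o}) : {ffun O -> k^o} :=
  [ffun o => t (projT1 (pt o))].
have res0 (t t' : {ffun Y -> k^o}) :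
    [ffun y => t (s y)] = t -> [ffun y => t' (s y)] = t' ->
    res t = res t' -> t = t'.
  move=> st st' /ffunP e; apply/ffunP=> y.
  have inv (v : {ffun Y -> k^o}) : [ffun y => v (s y)] = v ->
      forall z, z \in porbit s y -> v z = v y.
    move=> sv z /porbitP[i ->]; elim: i => [|i IH]; first by rewrite perm1.
    by rewrite expgSr permM -IH -[in RHS]sv ffunE.
  have := e (cls y); rewrite !ffunE; case: (pt _) => z /= ez.
  by rewrite !inv // -?eq_porbit_mem ez.
have sext u : [ffun y => ext u (s' y)] = ext u.
  apply/ffunP=> y; rewrite !ffunE; congr (u _); apply: val_inj => /=.
  by rewrite -[s']expg1 porbit_perm.
have := @ffun_inj_leq_card O' O (fun u => res (L (ext u))).
rewrite !card_sig; apply=> [a u v|u v e].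
  have -> : ext (a *: u + v) = a *: ext u + ext v.
    by apply/ffunP=> y; rewrite !ffunE.
  by rewrite lin; apply/ffunP=> o; rewrite !ffunE.
have /inj /ffunP euv : L (ext u) = L (ext v).
  by apply: res0 e; rewrite -comm sext.
apply/ffunP=> o; have := euv (projT1 (pt' o)); rewrite !ffunE.
by case: (pt' o) => y /= ey; rewrite (_ : cls' y = o) //; apply: val_inj.
Qed.

End PermutationModules.

(** Brauer's permutation lemma, in arbitrary characteristic. *)
Lemma conjugate_card_porbits (k : fieldType) (Y Y' : finType) (s : {perm Y})
    (s' : {perm Y'}) (L : {ffun Y' -> k^o} -> {ffun Y -> k^o}) :
  linear L -> bijective L ->
  (forall t : {ffun Y' -> k^o}, L [ffun y => t (s' y)] = [ffun y => L t (s y)]) ->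
  forall n, #|porbits (s ^+ n)%g| = #|porbits (s' ^+ n)%g|.
Proof.
move=> lin [L' LK L'K] comm n.
have lin' : linear L'.
  by move=> a u v; apply: (can_inj LK); rewrite L'K lin !L'K.
have comm' (t : {ffun Y -> k^o}) : L' [ffun y => t (s y)] = [ffun y => L' t (s' y)].
  by apply: (can_inj LK); rewrite L'K comm L'K.
have commX (t : {ffun Y' -> k^o}) :
    L [ffun y => t ((s' ^+ n)%g y)] = [ffun y => L t ((s ^+ n)%g y)].
  elim: n t => [|m IH] t.
    rewrite (_ : [ffun _ => _] = t); last by apply/ffunP=> y; rewrite ffunE perm1.
    by apply/ffunP=> y; rewrite ffunE perm1.
  transitivity (L [ffun y => [ffun z => t (s' z)] ((s' ^+ m)%g y)]).
    by congr L; apply/ffunP=> y; rewrite !ffunE expgSr permM.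
  by rewrite IH comm; apply/ffunP=> y; rewrite !ffunE expgSr permM.
have commX' (t : {ffun Y -> k^o}) :
    L' [ffun y => t ((s ^+ n)%g y)] = [ffun y => L' t ((s' ^+ n)%g y)].
  by apply: (can_inj LK); rewrite L'K commX L'K.
apply/eqP; rewrite eqn_leq.
rewrite (intertwine_leq_porbits lin (can_inj LK) commX).
by rewrite (intertwine_leq_porbits lin' (can_inj L'K) commX').
Qed.

Lemma sum_inv_card_porbit (Y : finType) (s : {perm Y}) :
  \sum_y (#|porbit s y|%:R)^-1 = #|porbits s|%:R :> rat.
Proof.
rewrite (partition_big_imset (porbit s)) /= -sum1_card natr_sum.
apply: eq_bigr => o /imsetP[x _ ->].
rewrite (eq_bigr (fun=> (#|porbit s x|%:R)^-1)); last by move=> y /eqP->.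
rewrite sumr_const -[LHS]mulr_natl.
rewrite (eq_card (B := porbit s x)) => [|y]; last exact: eq_porbit_mem.
by rewrite divff // pnatr_eq0 card_porbit_neq0.
Qed.

Lemma gcdn_sum_totient d n : (0 < n)%N ->
  gcdn d n = (\sum_(e < n.+1 | (e %| n) && (e %| d)) totient e)%N.
Proof.
move=> n_gt0; have gn : (gcdn d n <= n)%N by rewrite dvdn_leq ?dvdn_gcdr.
rewrite -[LHS]sum_totient_dvd.
rewrite [LHS](big_ord_widen_cond n.+1 (fun e => (e %| gcdn d n)%N) totient) //=.
apply: eq_bigl => e; rewrite dvdn_gcd [(e %| d)%N && _]andbC.
apply: andb_idr => /andP[en ed].
by rewrite ltnS dvdn_leq ?gcdn_gt0 ?n_gt0 ?orbT // dvdn_gcd ed.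
Qed.

(** Expanding gcd (d, n) as the sum of totient e over the common divisors e
    gives the sum over e | n of totient e * T e, where T e is the sum of w
    over the multiples of e.  So T vanishes by induction, and then w vanishes
    from the largest index downwards. *)
Lemma gcd_combination_eq0 (N : nat) (w : nat -> rat) :
  (forall n, (0 < n)%N -> \sum_(1 <= d < N) w d * (gcdn d n)%:R = 0) ->
  forall d, (0 < d < N)%N -> w d = 0.
Proof.
move=> h; pose T e := \sum_(1 <= d < N | (e %| d)%N) w d.
have T0 n : (0 < n)%N -> T n = 0.
  elim/ltn_ind: n => n IH n_gt0; have := h n n_gt0.
  have -> : \sum_(1 <= d < N) w d * (gcdn d n)%:R =
      \sum_(e < n.+1 | (e %| n)%N) (totient e)%:R * T e.
    rewrite (eq_bigr (fun d => \sum_(e < n.+1 | ((e %| n) && (e %| d))%N)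
       w d * (totient e)%:R)); last first.
      by move=> d _; rewrite (gcdn_sum_totient d n_gt0) natr_sum mulr_sumr.
    rewrite (exchange_big_dep (fun e : 'I_n.+1 => (e %| n)%N)) /=; last first.
      by move=> d e _ /andP[].
    apply: eq_bigr => e en; rewrite /T mulr_sumr; apply: eq_big => [d|d _].
      by rewrite en.
    by rewrite mulrC.
  rewrite (bigD1 ord_max) ?dvdnn //= big1 ?addr0 => [|e /andP[en ne]].
    move/eqP; rewrite mulf_eq0 pnatr_eq0 -leqn0 leqNgt totient_gt0 n_gt0.
    by move/eqP.
  have e_gt0 : (0 < e)%N by rewrite (dvdn_gt0 n_gt0).
  rewrite IH ?mulr0 // ltn_neqAle -ltnS ltn_ord andbT.
  by apply: contraNneq ne => en'; apply/eqP/val_inj.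
suff H m d : (N - d <= m)%N -> (0 < d < N)%N -> w d = 0.
  by move=> d; apply: (H N); apply: leq_subr.
elim: m d => [|m IH] d; first by lia.
move=> dm d_bnd; have d_gt0 : (0 < d)%N by case/andP: d_bnd.
rewrite -(T0 d d_gt0) /T big_mkcond (bigD1_seq d) ?mem_index_iota ?iota_uniq //=.
rewrite dvdnn big_seq_cond big1 ?addr0 // => e /andP[]; rewrite mem_index_iota.
move=> e_bnd ne; case: ifP => // de; have le_de : (d <= e)%N.
  by rewrite dvdn_leq //; case/andP: e_bnd.
by apply: IH => //; lia.
Qed.

(** * Cycles of the powers of the turn *)

Section TurnOrbits.
Variables (G : finGroupType) (S : finType).
Implicit Types (y : loopIdx G S).

Definition turnPerm : {perm loopIdx G S} := perm (can_inj (@turnK G S)).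

Lemma turnPermX n y :
  (turnPerm ^+ n)%g y = (y.1, ((y.1.1^-1 ^+ n * y.2.1)%g, y.2.2)).
Proof.
elim: n => [|n IH]; first by rewrite perm1 mul1g; case: y => ? [].
by rewrite expgSr permM IH permE /turn /= expgS mulgA.
Qed.

Lemma card_porbit_turn n y : #|porbit (turnPerm ^+ n)%g y| = #[(y.1.1 ^+ n)%g]%g.
Proof.
pose f (h : G) : loopIdx G S := (y.1, ((h * y.2.1)%g, y.2.2)).
have finj : injective f by move=> h h' [/mulIg].
rewrite -orderV -expgVn orderE -(card_imset _ finj); apply: eq_card => z.
apply/porbitP/imsetP => [[i ->]|[h /cycleP[i ->] ->]].
  by exists ((y.1.1^-1 ^+ n) ^+ i)%g; rewrite ?mem_cycle //
    -[(turnPerm ^+ _ ^+ _)%g]expgM turnPermX expgM.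
by exists i; rewrite -[(turnPerm ^+ _ ^+ _)%g]expgM turnPermX expgM.
Qed.

Definition order_count d := #|[set x : G | #[x]%g == d]|.

Lemma sum_inv_order n N : (#|G| < N)%N ->
  \sum_(g : G) (#[(g ^+ n)%g]%g%:R)^-1 =
  \sum_(1 <= d < N) (order_count d)%:R / d%:R * (gcdn d n)%:R :> rat.
Proof.
move=> ltN; have ord_lt (g : G) : (#[g]%g < N)%N.
  by apply: leq_ltn_trans ltN; rewrite -cardsT subset_leq_card // subsetT.
transitivity (\sum_(d < N) \sum_(g : G | #[g]%g == d) (#[(g ^+ n)%g]%g%:R)^-1 : rat).
  rewrite (exchange_big_dep xpredT) //=; apply: eq_bigr => g _.
  rewrite (bigD1 (Ordinal (ord_lt g))) ?eqxx //= big1 ?addr0 // => i.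
  by case/andP=> /eqP gi /eqP[]; apply: val_inj.
rewrite -(big_mkord xpredT (fun d => \sum_(g : G | #[g]%g == d) (#[(g ^+ n)%g]%g%:R)^-1 : rat)).
rewrite big_ltn ?(leq_ltn_trans _ ltN) // big1 ?add0r => [|g /eqP o0]; last first.
  by have := order_gt0 g; rewrite o0.
apply: eq_big_nat => d /andP[d_gt0 _].
rewrite (eq_bigr (fun=> (gcdn d n)%:R / d%:R)); last first.
  move=> g /eqP <-; rewrite orderXgcd natf_div ?dvdn_gcdl //; last by rewrite invf_div.
rewrite sumr_const -[LHS]mulr_natl mulrA mulrAC /order_count; congr (_%:R * _ * _).
by apply: eq_card => g; rewrite inE.
Qed.

Lemma card_porbits_turn n N : (#|G| < N)%N ->
  (#|porbits (turnPerm ^+ n)%g|)%:R =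
  \sum_(1 <= d < N) (#|S| ^ 2 * #|G|)%:R * ((order_count d)%:R / d%:R) * (gcdn d n)%:R
  :> rat.
Proof.
move=> ltN; rewrite -sum_inv_card_porbit.
under eq_bigr => y _ do rewrite card_porbit_turn.
under [RHS]eq_bigr => d _ do rewrite -mulrA.
rewrite -mulr_sumr -(sum_inv_order n ltN).
rewrite -(pair_bigA _ (fun (p : G * S) (q : G * S) => (#[(p.1 ^+ n)%g]%g%:R)^-1)) /=.
rewrite -(pair_bigA _ (fun (g : G) (i : S) =>
  \sum_(q : G * S) (#[(g ^+ n)%g]%g%:R)^-1)) /=.
rewrite mulr_sumr; apply: eq_bigr => g _.
rewrite !sumr_const card_prod -mulrnA -[LHS]mulr_natl; congr (_%:R * _).
rewrite [X in (_ * X)%N](eq_card (B := S)) //.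
by rewrite -mulnn -mulnA mulnC.
Qed.

End TurnOrbits.

Lemma order_count1 (G : finGroupType) : order_count G 1 = 1%N.
Proof.
rewrite /order_count (_ : [set _ | _] = [set 1%g]) ?cards1 //.
by apply/setP=> x; rewrite !inE order_eq1.
Qed.

Lemma order_count_eq (G G' : finGroupType) (S S' : finType) : (0 < #|S|)%N ->
  (forall n, #|porbits (turnPerm G S ^+ n)%g| = #|porbits (turnPerm G' S' ^+ n)%g|) ->
  forall d, (0 < d)%N -> order_count G d = order_count G' d.
Proof.
(* N exceeds 1, d and the orders of all elements of both groups. *)
move=> S_gt0 eqn d d_gt0; pose N := (#|G| + #|G'| + d + 2)%N.
pose c : rat := (#|S| ^ 2 * #|G|)%:R; pose c' : rat := (#|S'| ^ 2 * #|G'|)%:R.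
have key e : (0 < e < N)%N -> c * (order_count G e)%:R = c' * (order_count G' e)%:R.
  move=> e_bnd; have e0 : e%:R != 0 :> rat by rewrite pnatr_eq0 -lt0n; case/andP: e_bnd.
  have /eqP : c * ((order_count G e)%:R / e%:R) -
      c' * ((order_count G' e)%:R / e%:R) = 0.
    apply: (@gcd_combination_eq0 N (fun e => c * ((order_count G e)%:R / e%:R) -
      c' * ((order_count G' e)%:R / e%:R))) e_bnd => n n_gt0.
    under eq_bigr => i _ do rewrite mulrBl.
    rewrite sumrB -(@card_porbits_turn G S n N) -?(@card_porbits_turn G' S' n N).
    - by rewrite eqn subrr.
    - by rewrite /N; lia.
    - by rewrite /N; lia.
  by rewrite !mulrA -mulrBl mulf_eq0 invr_eq0 (negPf e0) orbF subr_eq0 => /eqP.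
have cc' : c = c'.
  by have := key 1%N; rewrite !order_count1 !mulr1; apply; rewrite /N; lia.
have c_neq0 : c != 0.
  rewrite /c pnatr_eq0 -lt0n muln_gt0 expn_gt0 S_gt0 /=.
  by apply/card_gt0P; exists 1%g.
have := key d; rewrite -cc' => h; apply/eqP; rewrite -(eqr_nat rat).
by apply/eqP; apply: (mulfI c_neq0); apply: h; rewrite /N; lia.
Qed.

(** * Turns conjugate under a monoidal equivalence *)

Section Conjugacy.
Variables (k : fieldType) (G G' : finGroupType) (S S' : finType) (s0 : S) (s0' : S').
Variables (F : linMonFunctor (Mod (groupHopf k G)) (Mod (groupHopf k G'))).
Variables (A : leftModule (groupHopf k G)) (B : leftModule (groupHopf k G')).
Variables (A_free : freeModule S A) (B_free : freeModule S' B).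
Variable psi : hom (B : Mod (groupHopf k G')) (F A).
Hypothesis psi_iso : is_iso psi.
Hypothesis F_faithful : forall X Y (f g : hom X Y), fmap F f = fmap F g -> f = g.
Hypothesis F_full : forall X Y (f' : hom (F X) (F Y)), exists f, fmap F f = f'.

Let L (t : {ffun loopIdx G' S' -> k^o}) : {ffun loopIdx G S -> k^o} :=
  loopCoord A_free s0 (pullback psi (combForm B_free t)).

Let pull_cyc t : cyclic_form (pullback psi (combForm B_free t)).
Proof. by apply: pullback_cyclic => //; apply: combForm_cyclic. Qed.

Let LE t r f : combForm A_free (L t) r f = pullback psi (combForm B_free t) r f.
Proof. by apply: combForm_coord; apply: pull_cyc. Qed.

Let combForm_inj t t' :
  (forall r f, combForm A_free t r f = combForm A_free t' r f) -> t = t'.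
Proof. by move=> e; apply/ffunP=> y; rewrite -!(combForm_dualLoop A_free s0) e. Qed.

Let combForm_inj' t t' :
  (forall r f, combForm B_free t r f = combForm B_free t' r f) -> t = t'.
Proof. by move=> e; apply/ffunP=> y; rewrite -!(combForm_dualLoop B_free s0') e. Qed.

Lemma card_porbits_turn_equiv n :
  #|porbits (turnPerm G S ^+ n)%g| = #|porbits (turnPerm G' S' ^+ n)%g|.
Proof.
have Llin : linear L.
  by move=> a t t'; apply/ffunP=> y; rewrite !ffunE /pullback combForm_linear.
have Linj : injective L.
  move=> t t' e; apply: combForm_inj'; apply: (pullback_inj psi_iso F_full) => r f.
  by rewrite -!LE e.
have Lsurj u : exists t, L t = u.
  have [sigma cyc es] := pullback_surj psi_iso F_faithful F_full (combForm_cyclic A_free u).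
  exists (loopCoord B_free s0' sigma); apply: combForm_inj => r f.
  by rewrite LE /pullback combForm_coord // -es.
have Lbij : bijective L.
  exists (fun u => projT1 (cid (Lsurj u))) => t; last by case: cid.
  by case: cid => t' /= /Linj.
apply: (conjugate_card_porbits Llin Lbij) => t; apply: combForm_inj => r f.
have -> (u : {ffun loopIdx G S -> k^o}) :
  [ffun y => u (turnPerm G S y)] = [ffun y => u (turn y)].
  by apply/ffunP=> y; rewrite !ffunE permE.
rewrite -combForm_twist LE /twist LE.
have -> : [ffun y => t (turnPerm G' S' y)] = [ffun y => t (turn y)].
  by apply/ffunP=> y; rewrite !ffunE permE.
rewrite -/(twist (pullback psi (combForm B_free t)) r f) -pullback_twist //.
by rewrite /pullback combForm_twist.
Qed.

End Conjugacy.

(** * Tensor products with free modules *)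

(** The basis vectors x v (x) x e_j untwist the diagonal action: next to a free
    module, V behaves like a trivial module of the same dimension. *)
Section TensorFree.
Variables (k : fieldType) (G : finGroupType) (S : finType).
Local Notation H := (groupHopf k G).
Variables (A : leftModule H) (A_free : freeModule S A).
Variables (V : leftModule H) (b : dualBasis V) (b_free : free_db b).
Local Notation fbase := (fbase A_free).
Local Notation fcoord := (fcoord A_free).
Local Notation T := (db_idx b * S)%type.
Implicit Types (p q : G * T).

Definition tensor_base p : tensorMod V A :=
  eltact p.1 (db_vec b p.2.1) *t fbase (p.1, p.2.2).

Definition tensor_coord p : tensorMod V A -> k^o :=
  db_cov b p.2.1 \o @eltact k G V p.1^-1%g \o contract (fcoord (p.1, p.2.2)).

Fact tensor_coord_linear p : linear (tensor_coord p).
Proof. exact: lin_comp (linearP _) (lin_comp (linearP _) (linearP _)). Qed.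
HB.instance Definition _ p :=
  GRing.isLinear.Build k (tensorMod V A) k^o *:%R (tensor_coord p)
    (tensor_coord_linear p).

Fact tensor_coordE p q : tensor_coord p (tensor_base q) = (p == q)%:R.
Proof.
case: p q => [g [i j]] [h [i' j']]; rewrite /tensor_coord /tensor_base /=.
rewrite contractE fcoordE eltactZ linearZ /= !xpair_eqE.
case: eqP => [->|_] /=; last by rewrite scale0r.
by rewrite eltactK b_free andbC -[LHS]natrM mulnb.
Qed.

Fact tensor_base_sum t : t = \sum_p (tensor_coord p t : k) *: tensor_base p.
Proof.
pose F (t : tensorMod V A) : tensorMod V A :=
  \sum_p (tensor_coord p t : k) *: tensor_base p.
have lF : linear F.
  move=> a u v; rewrite scaler_sumr -big_split; apply: eq_bigr => p _ /=.
  by rewrite tensor_coord_linear scalerDl scalerA.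
move: t; refine (@tens_ext k V A (tensorMod V A) idfun F (@lin_id _ _) lF _) => v u.
move: u; refine (@freeModule_ext k G S A A_free (tensorMod V A) (fun u => v *t u)
  (fun u => F (v *t u)) ((tens_bilinear V A).2 v)
  (lin_comp lF ((tens_bilinear V A).2 v)) _) => -[g j].
have cE p : tensor_coord p (v *t fbase (g, j)) =
    (((p.1, p.2.2) == (g, j))%:R : k) *: db_cov b p.2.1 (eltact g^-1%g v).
  rewrite /tensor_coord /= contractE fcoordE eltactZ linearZ /= xpair_eqE.
  by case: eqP => [->|_] //; rewrite !scale0r.
rewrite /F -(pair_bigA _ (fun h (w : T) =>
  (tensor_coord (h, w) (v *t fbase (g, j)) : k) *: tensor_base (h, w))) /=.
rewrite (bigD1 g) //= [X in _ + X]big1 => [|h nh].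
  rewrite addr0 -(pair_bigA _ (fun i l =>
    (tensor_coord (g, (i, l)) (v *t fbase (g, j)) : k) *: tensor_base (g, (i, l)))) /=.
  rewrite -[v in LHS](eltactKV g) [eltact g^-1%g v in LHS](db_sum b).
  rewrite eltact_sum (big_morph (fun v => v *t fbase (g, j)) (tensDl _) (tens0l _ _)).
  apply: eq_bigr => i _; rewrite (bigD1 j) //= big1 ?addr0 => [|l nl].
    by rewrite cE eqxx scale1r eltactZ tensZl.
  by rewrite cE xpair_eqE (negPf nl) andbF !scale0r.
by rewrite big1 // => w _; rewrite cE xpair_eqE (negPf nh) !scale0r.
Qed.

Fact eltact_tensor_base x p :
  eltact x (tensor_base p) = tensor_base ((x * p.1)%g, p.2).
Proof. by rewrite eltact_tens -eltactM eltact_fbase. Qed.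

Definition tensorFree : freeModule T (tensorMod V A) :=
  @FreeModule k G T (tensorMod V A) tensor_base (fun p => tensor_coord p)
    tensor_coordE tensor_base_sum eltact_tensor_base.

End TensorFree.

Definition transportFree (k : fieldType) (G : finGroupType) (S : finType)
    (M N : leftModule (groupHopf k G)) (M_free : freeModule S M)
    (f : moduleHom M N) (f' : moduleHom N M) :
  cancel f f' -> cancel f' f -> freeModule S N.
Proof.
move=> fK f'K; apply: (@FreeModule k G S N (fun p => f (fbase M_free p))
  (fun p => fcoord M_free p \o f')) => [p q|u|x p] /=.
- by rewrite fK fcoordE.
- rewrite -[LHS]f'K [f' u in LHS](fbase_sum M_free) linear_sum.
  by apply: eq_bigr => p _; rewrite linearZ.
- by rewrite -moduleHom_eltact eltact_fbase.
Defined.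

(** The group algebra is cocommutative, so the flip is equivariant. *)
Section Flip.
Variables (k : fieldType) (G : finGroupType).
Local Notation H := (groupHopf k G).
Variables (M N : leftModule H).

Definition tflip : tensorMod M N -> tensorMod N M := tlift (fun v w => w *t v).

Fact tflip_bilinear :
  bilinear_for *:%R *:%R (fun (v : M) (w : N) => w *t v).
Proof. by split=> u a x y /=; rewrite !tensE. Qed.
HB.instance Definition _ := GRing.isLinear.Build k (tensorMod M N) (tensorMod N M)
  *:%R tflip (tlift_linear tflip_bilinear).

Lemma tflipE v w : tflip (v *t w) = w *t v.
Proof. exact: tliftE tflip_bilinear _ _. Qed.

Fact tflip_eltact x (t : tensorMod M N) : tflip (eltact x t) = eltact x (tflip t).
Proof.
move: t; refine (@tens_ext k M N (tensorMod N M)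
  (fun t => tflip (eltact x (t : tensorMod M N)))
  (fun t => eltact x (tflip t)) _ _ _) => [||v w].
- exact: lin_comp (linearP tflip) (linearP (@eltact k G (tensorMod M N) x)).
- exact: lin_comp (linearP (@eltact k G (tensorMod N M) x)) (linearP tflip).
by rewrite eltact_tens !tflipE eltact_tens.
Qed.

Definition flipHom : moduleHom (tensorMod M N) (tensorMod N M) :=
  eltHom (M := tensorMod M N) (N := tensorMod N M) tflip_eltact.
End Flip.

Lemma flipHomK (k : fieldType) (G : finGroupType) (M N : leftModule (groupHopf k G)) :
  cancel (flipHom M N) (flipHom N M).
Proof.
pose ff := compHom (flipHom N M) (flipHom M N).
refine (@tens_ext k M N (tensorMod M N) ff idfun (moduleHom_linear ff)
  (@lin_id _ _) _) => v w.
by rewrite /= !tflipE.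
Qed.

(** * Finiteness of the images of the regular modules *)

Lemma span_of_subset (k : fieldType) (V : vectType k) (P : V -> Prop) :
  exists X : seq V, (forall x, x \in X -> P x) /\ (forall y, P y -> y \in <<X>>%VS).
Proof.
pose dims n := `[< exists2 X : seq V, (forall x, x \in X -> P x) & \dim <<X>>%VS = n >].
have ex : exists n, dims n.
  by exists 0%N; apply/asboolP; exists [::]; rewrite ?span_nil ?dimv0.
have bnd n : dims n -> (n <= \dim {:V})%N.
  by case/asboolP=> X _ <-; apply/dimvS/subvf.
have [n /asboolP[X XP dX] max] := ex_maxnP ex bnd.
exists X; split=> // y Py; apply: contraT => ny.
have : (\dim <<y :: X>>%VS <= n)%N.
  apply: max; apply/asboolP; exists (y :: X) => // x.
  by rewrite inE => /predU1P[->|/XP].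
rewrite leqNgt -dX span_cons; case/negP.
rewrite ltn_neqAle dimvS ?addvSr // andbT; apply: contra ny => /eqP e.
have /eqP-> : <<X>>%VS == (<[y]> + <<X>>)%VS by rewrite eqEdim addvSr e /=.
exact: (subvP (addvSl _ _)) (memv_line y).
Qed.

Lemma separating_functional (k : fieldType) (I : finType) (U : {vspace {ffun I -> k^o}})
    (v : {ffun I -> k^o}) : v \notin U ->
  exists l : {ffun I -> k^o} -> k^o, [/\ linear l, forall u, u \in U -> l u = 0 & l v != 0].
Proof.
move=> nv; pose w := v - projv U v.
have [p wp] : exists p, w p != 0.
  apply/existsP; rewrite -negb_forall; apply: contra nv => /forallP w0.
  suff /eqP : w == 0 by move/eqP; rewrite subr_eq0 => /eqP->; apply: memv_proj.
  by apply/eqP/ffunP=> p; rewrite [RHS]ffunE; apply/eqP/w0.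
exists (fun u => (u - projv U u) p); split=> // [a x y|u uU].
  by rewrite linearP opprD addrACA -scalerBr !ffunE.
by rewrite projv_id // subrr ffunE.
Qed.

Section Finiteness.
Variables (k : fieldType) (G G' : finGroupType).
Local Notation C := (ModCat (groupHopf k G)).
Local Notation D := (ModCat (groupHopf k G')).
Local Notation R := (regMod k G).
Local Notation R' := (regMod k G').
Local Notation free' := (regMod_free k G').
Variables (F : linFunctor C D) (E : linFunctor D C).
Hypothesis FE_id : nat_iso (compFunctor F E) (idFunctor D).
Hypothesis EF_id : nat_iso (compFunctor E F) (idFunctor C).

(** Maps out of F R detect endomorphisms of R': seen through E, they become the
    maps from R to E R', and these reach every element. *)
Lemma detecting_endo (pi : moduleHom R' R') :
  (forall f : moduleHom (F R) R', compHom pi f = 0) -> pi = 0.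
Proof.
move=> pi0; apply: (nat_iso_id_faithful FE_id (A := R') (B := R')).
rewrite fmap0; apply: moduleHomP => q.
pose psi : hom (R : C) (E R') := freeHom (regMod_free k G) (M := E R') (fun=> q).
have : fmap E (pi : hom (R' : D) R') \mo psi = 0.
  apply: (nat_iso_id_faithful EF_id); rewrite fmap0.
  have [eps [eps_iso eps_nat]] := FE_id.
  apply: (iso_monic (eps_iso R')); rewrite mcomp0r fmapM.
  apply: etrans (mcompA _ _ _) _.
  apply: etrans (congr1 (fun f => f \mo fmap F psi) (eps_nat R' R' pi)) _.
  apply: etrans (esym (mcompA _ _ _)) _; exact: (pi0 (eps R' \mo fmap F psi)).
move/(congr1 (fun f : moduleHom _ _ => f (fbase (regMod_free k G) (1%g, tt)))).
by rewrite /= free_extE eltact1.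
Qed.

(** If 1 is a combination of values of maps F R -> R', then R' is a retract of a
    finite sum of copies of F R.  Otherwise a linear form l separates 1 from
    these values, and y |-> sum_h l (h^-1 y) h is a nonzero endomorphism of R'
    that kills all maps F R -> R'. *)
Lemma regMod_retract : exists n (u : 'I_n -> moduleHom (F R) R')
    (v : 'I_n -> moduleHom R' (F R)), \sum_i compHom (u i) (v i) = idHom R'.
Proof.
pose P (y : {ffun G' * unit -> k^o}) :=
  exists (f : moduleHom (F R) R') b, y = f b.
have [X [XP PX]] := span_of_subset P.
pose e1 : R' := fbase free' (1%g, tt).
have [Xe|] := boolP ((e1 : {ffun G' * unit -> k^o}) \in <<X>>%VS).
  have XPi (i : 'I_(size X)) : P X`_i by apply/XP/mem_nth.
  pose u i := projT1 (cid (XPi i)); pose b i := projT1 (cid (projT2 (cid (XPi i)))).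
  have ub (i : 'I_(size X)) : X`_i = u i (b i).
    by rewrite /u /b; case: (cid (XPi i)) => f h /=; case: cid.
  pose a (i : 'I_(size X)) : k := coord (in_tuple X) i (e1 : {ffun G' * unit -> k^o}).
  exists (size X), u, (fun i => freeHom free' (fun=> a i *: b i)).
  apply: (freeHom_ext (A_free := free')) => -[]; rewrite moduleHom_sumE.
  rewrite [RHS](coord_span (X := in_tuple X) Xe); apply: eq_bigr => i _.
  rewrite -[LHS]/(u i (freeHom free' (fun=> a i *: b i) (fbase free' (1%g, tt)))).
  by rewrite freeHomE eltact1 (linZ (moduleHom_linear (u i))) -ub.
case/separating_functional=> l [lin l0 le1].
pose pf (y : R') : R' := \sum_h (l (eltact h^-1%g y) : k) *: fbase free' (h, tt).
have pL : linear pf.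
  move=> c x y; rewrite scaler_sumr -big_split; apply: eq_bigr => h _ /=.
  by rewrite linearP lin scalerDl scalerA.
pose pl := HB.pack_for {linear R' -> R'} pf (GRing.isLinear.Build k R' R' *:%R pf pL).
have pG x y : pl (eltact x y) = eltact x (pl y).
  rewrite [RHS]eltact_sum [LHS](reindex_inj (mulgI x)); apply: eq_bigr => h _.
  by rewrite eltactZ eltact_fbase -eltactM invMg -mulgA mulVg mulg1.
have pf1 : fcoord free' (1%g, tt) (pf e1) = l e1.
  rewrite /pf linear_sum (bigD1 1%g) // big1 => [|h nh]; rewrite linearZ fcoordE.
    by rewrite eqxx invg1 eltact1 /= addr0 /GRing.scale /= mulr1.
  by rewrite xpair_eqE eq_sym (negPf nh); apply: scaler0.
have : eltHom pG = 0.
  apply: detecting_endo => f; apply: moduleHomP => c /=.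
  rewrite /pf big1 // => h _; rewrite l0 ?scale0r //; apply: PX.
  by exists f, (eltact h^-1%g c); rewrite moduleHom_eltact.
move/(congr1 (fun f : moduleHom _ _ => fcoord free' (1%g, tt) (f e1))).
rewrite [LHS]pf1 [RHS]linear0 => l0e.
by rewrite l0e eqxx in le1.
Qed.

(** Applying E to the retraction makes E R' a retract of a finite sum of copies
    of E (F R), which is R. *)
Lemma equivalence_reg_basis : inhabited (dualBasis (E R')).
Proof.
have [n [u [v uv]]] := regMod_retract; have [eta [eta_iso eta_nat]] := EF_id.
pose u' i : moduleHom R (E R') := fmap E (u i : hom (F R) (R' : D)) \mo minv (eta R).
pose v' i : moduleHom (E R') R := eta R \mo fmap E (v i : hom (R' : D) (F R)).
have uv' : \sum_i compHom (u' i) (v' i) = idHom (E R').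
  apply: etrans (fmap1 E (R' : D)).
  apply: etrans (congr1 (fun f => fmap E (f : hom (R' : D) R')) uv).
  apply: etrans (esym (fmap_sum E _ _)); apply: eq_bigr => i _.
  apply: etrans (esym (fmapM E _ _)).
  apply: etrans (esym (mcompA _ _ _)) _; congr (_ \mo _).
  by apply: etrans (mcompA _ _ _) _; rewrite (minvKl (eta_iso R)) mcomp1m.
constructor; apply: (@retractBasis k (E R') R (freeBasis (regMod_free k G)) n u' v').
by move=> x; have := congr1 (fun f : moduleHom _ _ => f x) uv'; rewrite /= moduleHom_sumE.
Qed.

Lemma equivalence_reg_idx (b : dualBasis (E R')) : (0 < #|db_idx b|)%N.
Proof.
rewrite lt0n; apply/eqP=> b0.
have E0 (x : E R') : x = 0.
  by rewrite [x](db_sum b) big1 // => i _; have := card0_eq b0 i; rewrite inE.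
have id0 : idmor (R' : D) = 0.
  apply: (nat_iso_id_faithful FE_id); rewrite fmap1 fmap0.
  by apply: moduleHomP => x; rewrite [LHS]E0 [RHS]E0.
have := congr1 (fun f : moduleHom R' R' =>
  fcoord free' (1%g, tt) (f (fbase free' (1%g, tt)))) id0.
rewrite [LHS]fcoordE [RHS]linear0 eqxx => /eqP; apply/negP; exact: oner_neq0.
Qed.

End Finiteness.

(** * Isocategorical groups *)

Theorem theorem1p1 (k : fieldType) (G G' : finGroupType)
    (isoGG' : isocategorical k G G') (n : nat) (n_gt0 : (0 < n)%N) :
  #|[set x : G | #[x]%g == n]| = #|[set x : G' | #[x]%g == n]|.
Proof.
have [F [E [EF_id FE_id]]] := isoGG'.
pose R := regMod k G; pose R' := regMod k G'.
pose Q : leftModule (groupHopf k G) := E R'.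
pose P : leftModule (groupHopf k G') := F (R : Mod (groupHopf k G)).
have [bQ0] : inhabited (dualBasis Q) by apply: equivalence_reg_basis FE_id EF_id.
have [bP0] : inhabited (dualBasis P) by apply: equivalence_reg_basis EF_id FE_id.
have [bQ bQ_free] := exists_free_db bQ0; have [bP bP_free] := exists_free_db bP0.
have Q_gt0 : (0 < #|db_idx bQ|)%N by apply: equivalence_reg_idx FE_id bQ.
have P_gt0 : (0 < #|db_idx bP|)%N by apply: equivalence_reg_idx EF_id bP.
have /card_gt0P[q0 _] := Q_gt0; have /card_gt0P[p0 _] := P_gt0.
pose A_free := transportFree (tensorFree (regMod_free k G) bQ_free)
  (@flipHomK k G Q R) (@flipHomK k G R Q).
pose B_free := tensorFree (regMod_free k G') bP_free.
have [eps [eps_iso eps_nat]] := FE_id.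
(* F (R (x) E R') = F R (x) F (E R') = F R (x) R' *)
pose psi : hom (tensorMod P R' : Mod (groupHopf k G')) (F (tensorMod R Q)) :=
  mon2 F R Q \mo thom (idmor (F (R : Mod (groupHopf k G)))) (minv (eps R')).
have psi_iso : is_iso psi.
  apply: iso_comp; first exact: mon2_iso.
  exact: thom_iso (idmor_iso _) (minv_iso (eps_iso R')).
apply: (@order_count_eq G G' (db_idx bQ * unit)%type (db_idx bP * unit)%type) n_gt0.
  by rewrite card_prod card_unit muln1.
apply: (card_porbits_turn_equiv (q0, tt) (p0, tt) A_free B_free psi_iso).
  exact: (nat_iso_id_faithful EF_id).
exact: (nat_iso_id_full EF_id FE_id).
Qed.
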